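(* (Associativity) For any logarithmic vertex algebra $V$ with braiding map $\mathcal S$ and $a,b,c\in V$, there exists $N\in\mathbb Z_+$ such that $$\iota_{z_1,z_2}Y(z_{12},\zeta_{12})\bigl(I\otimes Y(-z_2,\zeta_2)\bigr)z_{12}^Ne^{\vartheta_{12}\mathcal S_{13}}(a\otimes b\otimes c)=Y(-z_2,\zeta_2)\bigl(Y(z_1,\zeta_1)\otimes I\bigr)z_{12}^Ne^{\vartheta_{21}\mathcal S_{13}}(a\otimes b\otimes c).$$
   Context: Conventions. All superspaces, tensor products and Hom's are over $\mathbb C$; $p(v)$ is the parity; formulas with $p$ are for homogeneous elements, extended linearly. $(\phi\otimes\psi)(a\otimes b)=(-1)^{p(\psi)p(a)}\phi(a)\otimes\psi(b)$; $[\cdot,\cdot]$ is the supercommutator; $P(a\otimes b)=(-1)^{p(a)p(b)}b\otimes a$; $I$ is the identity. $z,z_1,z_2$, $\zeta,\zeta_1,\zeta_2,\zeta_{12}$ are commuting even formal variables ($\zeta_i$ plays the role of $\log z_i$, $\zeta_{12}$ of $\log|z_{12}|$). $D_z=\partial_z+z^{-1}\partial_\zeta$, $z_{12}=z_1-z_2$, $\vartheta_{12}=\zeta_1-\sum_{n\ge1}\frac1n z_1^{-n}z_2^n$, $\vartheta_{21}=\zeta_2-\sum_{n\ge1}\frac1n z_1^{n}z_2^{-n}$. $\mathrm{LF}(V)=\mathrm{Hom}(V,V(\!(z)\!)[\zeta])$ with its natural superspace structure. Braiding map. A braiding map on $V$ is an even element $\mathcal S\in\mathrm{End}(V)\otimes\mathrm{End}(V)$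 with $\mathcal SP=P\mathcal S$ and $[\mathcal S_{12},\mathcal S_{23}]=[\mathcal S_{13},\mathcal S_{23}]=[\mathcal S_{12},\mathcal S_{13}]=0$ on $V^{\otimes3}$, where $\mathcal S_{12}=\mathcal S\otimes I$, $\mathcal S_{23}=I\otimes\mathcal S$, $\mathcal S_{13}=(I\otimes P)\mathcal S_{12}(I\otimes P)$. Logarithmic vertex algebra (logVA) $(V,\boldsymbol1,T,Y,\mathcal S)$: a superspace $V$, an even vector $\boldsymbol1$, an even $T\in\mathrm{End}(V)$, an even linear map $Y:V\to\mathrm{LF}(V)$, $a\mapsto Y(a,z)$, and a braiding map $\mathcal S$ on $V$ such that, with $Y(z)(a\otimes b):=Y(a,z)b$: (vacuum) $Y(\boldsymbol1,z)=I$, $Y(a,z)\boldsymbol1\in V[\![z]\!]$, $Y(a,z)\boldsymbol1|_{z=0}=a$, $T\boldsymbol1=0$; (covariance) $[T,Y(a,z)]=D_zY(a,z)$; (nilpotence) $\mathcal S$ is locally nilpotent on $V\otimes V$; (locality) for all $a,b\in V$ there is $N\in\mathbb Z_+$ such that for all $c\in V$, $Y(z_1)(I\otimes Y(z_2))z_{12}^Ne^{\vartheta_{12}\mathcal S_{12}}(a\otimes b\otimes c)=(-1)^{p(a)p(b)}Y(z_2)(I\otimes Y(z_1))z_{12}^Ne^{\vartheta_{21}\mathcal S_{12}}(b\otimes a\otimes c)$; (hexagon) $\mathcal S(Y(z)\otimes I)=(Y(z)\otimes I)(\mathcal S_{13}+\mathcal S_{23})$ on $V^{\otimes3}$. Notation.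 $Y(z,\zeta)=Y(z)$ with the dependence on $\zeta$ displayed; so $Y(-z_2,\zeta_2)$ replaces $z$ by $-z_2$ and $\zeta$ by $\zeta_2$, and $Y(z_{12},\zeta_{12})$ replaces $z$ by $z_{12}$ and $\zeta$ by $\zeta_{12}$. The map $\iota_{z_1,z_2}$ expands in the domain $|z_1|>|z_2|$: $\iota_{z_1,z_2}z_{12}^{-1}=\sum_{j\ge0}z_1^{-j-1}z_2^j$, $\iota_{z_1,z_2}\zeta_{12}=\vartheta_{12}$; it is multiplicative and fixes $z_i^{\pm1},\zeta_i$. *)

(* Defs.v *)
From HB Require Import structures.
From mathcomp Require Import all_boot all_order all_algebra generic_quotient.
From mathcomp Require Import boolp classical_sets fsbigop reals complex.

Set Implicit Arguments.
Unset Strict Implicit.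
Unset Printing Implicit Defensive.

Import Order.TTheory GRing.Theory Num.Theory.
Local Open Scope ring_scope.
Local Open Scope classical_set_scope.

Section TensorProduct.
Context {K : fieldType} {V W : lmodType K}.
Implicit Types (s t : seq (V * W)) (x y : V) (u w : W).

(* A sequence of pairs [:: (x1, w1); ...; (xn, wn)] stands for the formal sum
   of the x_i (x) w_i; the tensor product is the quotient by the congruence
   generated by bilinearity. *)
Inductive tens_eq : seq (V * W) -> seq (V * W) -> Prop :=
| tens_eq_refl s : tens_eq s s
| tens_eq_sym s t : tens_eq s t -> tens_eq t s
| tens_eq_trans s t r : tens_eq s t -> tens_eq t r -> tens_eq s r
| tens_eq_cat s s' t t' :
    tens_eq s s' -> tens_eq t t' -> tens_eq (s ++ t) (s' ++ t')
| tens_eq_comm s t : tens_eq (s ++ t) (t ++ s)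
| tens_eq0 w : tens_eq [:: (0, w)] [::]
| tens_eqDl x y w : tens_eq [:: (x + y, w)] [:: (x, w); (y, w)]
| tens_eqDr x u w : tens_eq [:: (x, u + w)] [:: (x, u); (x, w)]
| tens_eqZ (c : K) x w : tens_eq [:: (c *: x, w)] [:: (x, c *: w)].

Definition tens_rel (s t : seq (V * W)) : bool := `[< tens_eq s t >].

Lemma tens_rel_equiv : equiv_class_of tens_rel.
Proof.
split=> [s|s t|s t r].
- by apply/asboolP; apply: tens_eq_refl.
- by apply/asboolP/asboolP; apply: tens_eq_sym.
- by move=> /asboolP h1 /asboolP h2; apply/asboolP; apply: tens_eq_trans h1 h2.
Qed.

Canonical tens_equiv := EquivRelPack tens_rel_equiv.

Definition tensor : Type := {eq_quot tens_equiv}%qT.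

HB.instance Definition _ : EqQuotient _ tens_equiv tensor :=
  EqQuotient.on tensor.
HB.instance Definition _ := Choice.on tensor.

Definition tclass s : tensor := (\pi_tensor s)%qT.

Lemma tclassP s t : tclass s = tclass t <-> tens_eq s t.
Proof.
by split=> [/eqquotP/asboolP|h] //; apply/eqquotP; apply/asboolP.
Qed.

Lemma reprK_tens (t : tensor) : tclass (repr t) = t.
Proof. exact: reprK. Qed.

Lemma repr_tclass s : tens_eq (repr (tclass s)) s.
Proof. by apply/tclassP; rewrite reprK_tens. Qed.

Definition tens x w : tensor := tclass [:: (x, w)].

Definition tens_add (t1 t2 : tensor) : tensor := tclass (repr t1 ++ repr t2).
Definition tens_scale (c : K) (t : tensor) : tensor :=
  tclass [seq (c *: p.1, p.2) | p <- repr t].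
Definition tens_opp (t : tensor) : tensor := tens_scale (-1) t.
Definition tens_zero : tensor := tclass [::].

Lemma tens_addE s t : tens_add (tclass s) (tclass t) = tclass (s ++ t).
Proof. by apply/tclassP; apply: tens_eq_cat; apply: repr_tclass. Qed.

Lemma tens_eq_scale c s t : tens_eq s t ->
  tens_eq [seq (c *: p.1, p.2) | p <- s] [seq (c *: p.1, p.2) | p <- t].
Proof.
elim=> {s t} [s|s t _|s t r _ + _|s s' t t' _ + _|s t|w|x y w|x u w|a x w] /=.
- exact: tens_eq_refl.
- exact: tens_eq_sym.
- exact: tens_eq_trans.
- by move=> h1 h2; rewrite !map_cat; apply: tens_eq_cat.
- by rewrite !map_cat; apply: tens_eq_comm.
- by rewrite scaler0; apply: tens_eq0.
- by rewrite scalerDr; apply: tens_eqDl.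
- exact: tens_eqDr.
- by rewrite scalerA mulrC -scalerA; apply: tens_eqZ.
Qed.

Lemma tens_scaleE c s :
  tens_scale c (tclass s) = tclass [seq (c *: p.1, p.2) | p <- s].
Proof. by apply/tclassP; apply/tens_eq_scale; apply: repr_tclass. Qed.

Lemma tensorW (P : tensor -> Prop) : (forall s, P (tclass s)) -> forall t : tensor, P t.
Proof. by move=> h t; rewrite -(reprK_tens t). Qed.

Lemma tens_addA : associative tens_add.
Proof.
by elim/tensorW=> s; elim/tensorW=> t; elim/tensorW=> r; rewrite !tens_addE catA.
Qed.

Lemma tens_addC : commutative tens_add.
Proof.
elim/tensorW=> s; elim/tensorW=> t; rewrite !tens_addE.
by apply/tclassP; apply: tens_eq_comm.
Qed.

Lemma tens_add0 : left_id tens_zero tens_add.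
Proof. by elim/tensorW=> s; rewrite tens_addE. Qed.

Lemma tens_scaleDr c : {morph tens_scale c : t1 t2 / tens_add t1 t2}.
Proof.
by elim/tensorW=> s; elim/tensorW=> t; rewrite !(tens_addE, tens_scaleE) map_cat.
Qed.

Lemma tens_scaleDl (t : tensor) (a b : K) :
  tens_scale (a + b) t = tens_add (tens_scale a t) (tens_scale b t).
Proof.
elim/tensorW: t => s; rewrite !(tens_addE, tens_scaleE); apply/tclassP.
elim: s => [|[x w] s IHs] /=; first exact: tens_eq_refl.
rewrite -cat1s; apply: tens_eq_trans (tens_eq_cat _ IHs) _.
  by rewrite scalerDl; apply: tens_eqDl.
set A := map _ s; set B := map _ s.
apply: (@tens_eq_cat [:: _] [:: _] (([:: _] ++ A) ++ B)).
  exact: tens_eq_refl.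
rewrite -[_ :: B]cat1s catA.
by apply: tens_eq_cat; [exact: tens_eq_comm | exact: tens_eq_refl].
Qed.

Lemma tens_scale0 (t : tensor) : tens_scale 0 t = tens_zero.
Proof.
elim/tensorW: t => s; rewrite tens_scaleE; apply/tclassP.
elim: s => [|[x w] s IHs] /=; first exact: tens_eq_refl.
rewrite -cat1s -[[::]]/([::] ++ [::]) scale0r.
by apply: tens_eq_cat IHs; apply: tens_eq0.
Qed.

Lemma tens_scale1 : left_id 1 tens_scale.
Proof.
elim/tensorW=> s; rewrite tens_scaleE; congr tclass.
by rewrite -[RHS]map_id; apply: eq_map => -[x w] /=; rewrite scale1r.
Qed.

Lemma tens_scaleA a b (t : tensor) :
  tens_scale a (tens_scale b t) = tens_scale (a * b) t.
Proof.
elim/tensorW: t => s; rewrite !tens_scaleE -map_comp; congr tclass.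
by apply: eq_map => p /=; rewrite scalerA.
Qed.

Lemma tens_addN : left_inverse tens_zero tens_opp tens_add.
Proof.
move=> t; rewrite /tens_opp -[X in tens_add _ X]tens_scale1 -tens_scaleDl.
by rewrite addNr tens_scale0.
Qed.

HB.instance Definition _ :=
  GRing.isZmodule.Build tensor tens_addA tens_addC tens_add0 tens_addN.
HB.instance Definition _ :=
  GRing.Zmodule_isLmodule.Build K tensor
    tens_scaleA tens_scale1 tens_scaleDr tens_scaleDl.

(* The linear map induced by b; meaningful when b is bilinear (tlift_tens). *)
Definition tlift {U : lmodType K} (b : V -> W -> U) (t : tensor) : U :=
  \sum_(p <- repr t) b p.1 p.2.

Lemma tclassD s t : tclass (s ++ t) = tclass s + tclass t.
Proof. by rewrite -tens_addE. Qed.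

Lemma tclassE s : tclass s = \sum_(p <- s) tens p.1 p.2.
Proof.
elim: s => [|[x w] s IHs]; first by rewrite big_nil.
by rewrite big_cons -cat1s tclassD IHs.
Qed.

Lemma tensE (t : tensor) : t = \sum_(p <- repr t) tens p.1 p.2.
Proof. by rewrite -tclassE reprK_tens. Qed.

Lemma tens_bilinear : bilinear_for *:%R *:%R tens.
Proof.
have tZ c x w : tens (c *: x) w = c *: tens x w.
  by rewrite [RHS]tens_scaleE.
split=> [w c x y|x c u w] /=.
  by rewrite -tZ [RHS]tens_addE; apply/tclassP/tens_eqDl.
rewrite -tZ [RHS]tens_addE; apply/tclassP.
apply: tens_eq_trans (tens_eqDr _ _ _) _.
apply: (@tens_eq_cat [:: _] [:: _]); last exact: tens_eq_refl.
exact/tens_eq_sym/tens_eqZ.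
Qed.

Section Universal.
Variables (U : lmodType K) (b : V -> W -> U).
Hypothesis bP : bilinear_for *:%R *:%R b.

Let bl c x y w : b (c *: x + y) w = c *: b x w + b y w.
Proof. exact: bP.1. Qed.

Let br c x u w : b x (c *: u + w) = c *: b x u + b x w.
Proof. exact: bP.2. Qed.

Let b0l w : b 0 w = 0.
Proof. by have := bl (-1) 0 0 w; rewrite scaler0 addr0 scaleN1r addNr. Qed.

Let b0r x : b x 0 = 0.
Proof. by have := br (-1) x 0 0; rewrite scaler0 addr0 scaleN1r addNr. Qed.

Lemma tens_eq_sum s t : tens_eq s t ->
  \sum_(p <- s) b p.1 p.2 = \sum_(p <- t) b p.1 p.2.
Proof.
elim=> {s t} [s|s t _ ->|s t r _ -> _ ->|s s' t t' _ e1 _ e2|s t|w|x y w|x u w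
             |a x w] //.
- by rewrite !big_cat e1 e2.
- by rewrite !big_cat /= addrC.
- by rewrite big_seq1 big_nil.
- by rewrite big_seq1 !big_cons big_nil addr0 /= -[x]scale1r bl !scale1r.
- by rewrite big_seq1 !big_cons big_nil addr0 /= -[u]scale1r br !scale1r.
- by rewrite !big_seq1 /= -[a *: x]addr0 bl b0l -[a *: w]addr0 br b0r.
Qed.

Lemma tlift_tclass s : tlift b (tclass s) = \sum_(p <- s) b p.1 p.2.
Proof. exact/tens_eq_sum/repr_tclass. Qed.

Lemma tlift_tens x w : tlift b (tens x w) = b x w.
Proof. by rewrite tlift_tclass big_seq1. Qed.

Lemma tlift_linear : linear (tlift b).
Proof.
move=> c; elim/tensorW=> s; elim/tensorW=> t.
rewrite [c *: _]tens_scaleE -tclassD !tlift_tclass big_cat big_map scaler_sumr.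
congr (_ + _); apply: eq_bigr => p _ /=.
by rewrite -[c *: p.1]addr0 bl b0l addr0.
Qed.

End Universal.
End TensorProduct.

Arguments tensor {K} V W.

Notation "x ⊗ y" := (tens x y) (at level 35, right associativity) : ring_scope.

Section TensorMaps.
Context {K : fieldType}.
Implicit Types U V W : lmodType K.

(* Without Koszul sign: only used for g even. *)
Definition tmap {U U' V V' : lmodType K} (f : U -> U') (g : V -> V')
  : tensor U V -> tensor U' V' := tlift (fun u v => f u ⊗ g v).

Definition tassoc {U V W : lmodType K}
  : tensor (tensor U V) W -> tensor U (tensor V W) :=
  tlift (fun x w => tlift (fun u v => u ⊗ (v ⊗ w)) x).

Definition tassocV {U V W : lmodType K}
  : tensor U (tensor V W) -> tensor (tensor U V) W :=
  tlift (fun u x => tlift (fun v w => (u ⊗ v) ⊗ w) x).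

End TensorMaps.

(* Parities are booleans, [true] being odd, added by [addb]. *)
Record superspace (K : fieldType) := Superspace {
  super_sort :> lmodType K;
  spart : bool -> {linear super_sort -> super_sort};
  spart_proj : forall i j v,
    spart i (spart j v) = if i == j then spart j v else 0;
  spart_sum : forall v, spart false v + spart true v = v }.

Section Super.
Context {K : fieldType} {V : superspace K}.

Definition homog (i : bool) (v : V) : Prop := spart V i v = v.

Definition even_fun (f : V -> V) : Prop :=
  forall i v, f (spart V i v) = spart V i (f v).

(* The homogeneous component of parity j of f. *)
Definition hom_part (j : bool) (f : V -> V) (v : V) : V :=
  \sum_(i : bool) spart V (i (+) j) (f (spart V i v)).

(* The projection onto the component of parity k of the superspace V ⊗ V. *)
Definition tens_part (k : bool) : tensor V V -> tensor V V :=
  tlift (fun a b => \sum_(i : bool) spart V i a ⊗ spart V (i (+) k) b).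

(* (φ ⊗ ψ)(a ⊗ b) = (-1)^(p(ψ) p(a)) φ(a) ⊗ ψ(b) *)
Definition super_tmap (phi psi : V -> V) : tensor V V -> tensor V V :=
  tlift (fun a b => \sum_(i : bool) \sum_(j : bool)
    (-1) ^+ (i && j) *: (phi (spart V i a) ⊗ hom_part j psi b)).

(* P (a ⊗ b) = (-1)^(p(a) p(b)) b ⊗ a *)
Definition super_flip : tensor V V -> tensor V V :=
  tlift (fun a b => \sum_(i : bool) \sum_(j : bool)
    (-1) ^+ (i && j) *: (spart V j b ⊗ spart V i a)).

Definition on12 (S : tensor V V -> tensor V V)
  : tensor V (tensor V V) -> tensor V (tensor V V) :=
  fun x => tassoc (tmap S id (tassocV x)).

Definition on23 (S : tensor V V -> tensor V V)
  : tensor V (tensor V V) -> tensor V (tensor V V) := tmap id S.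

Definition on13 (S : tensor V V -> tensor V V)
  : tensor V (tensor V V) -> tensor V (tensor V V) :=
  fun x => on23 super_flip (on12 S (on23 super_flip x)).

(* Since S is even, supercommutators of the S_ij are commutators. *)
Record braiding_map (S : {linear tensor V V -> tensor V V}) : Prop := {
  braiding_End_End : exists s : seq ({linear V -> V} * {linear V -> V}),
    forall x, S x = \sum_(p <- s) super_tmap p.1 p.2 x;
  braiding_even : forall k x, S (tens_part k x) = tens_part k (S x);
  braiding_flip : forall x, S (super_flip x) = super_flip (S x);
  braiding_12_23 : forall x, on12 S (on23 S x) = on23 S (on12 S x);
  braiding_13_23 : forall x, on13 S (on23 S x) = on23 S (on13 S x);
  braiding_12_13 : forall x, on12 S (on13 S x) = on13 S (on12 S x) }.

End Super.

(* Formal series in z1, z2, ζ1, ζ2 are functions of the exponent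
   (i, j, (k, l)) of z1^i z2^j ζ1^k ζ2^l. Products are convolutions, written
   with finitely supported sums: whenever they occur below, only finitely many
   terms contribute to each coefficient. *)
Definition expo : Type := int * int * (nat * nat).
HB.instance Definition _ := GRing.Nmodule.on expo.

Section Series.
Context {K : numFieldType}.

Definition mono (i j : int) (k l : nat) : expo -> K :=
  fun e => (e == (i, j, (k, l)) :> expo)%:R.

Definition splits (e : expo) : set (expo * expo) :=
  [set p : expo * expo | p.1 + p.2 = e].

Definition smul (f g : expo -> K) : expo -> K :=
  fun e => \sum_(p \in splits e) f p.1 * g p.2.

Definition spow (f : expo -> K) (n : nat) : expo -> K :=
  iter n (smul f) (mono 0 0 0 0).

Definition sscale {U : lmodType K} (f : expo -> K) (w : expo -> U) : expo -> U :=
  fun e => \sum_(p \in splits e) f p.1 *: w p.2.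

Definition sapply {U W : lmodType K} (F : U -> expo -> W) (w : expo -> U)
  : expo -> W :=
  fun e => \sum_(p \in splits e) F (w p.2) p.1.

Definition z1 (n : int) : expo -> K := mono n 0 0 0.
Definition z2 (n : int) : expo -> K := mono 0 n 0 0.
Definition opp_z2 (n : int) : expo -> K := fun e => (-1) ^ n * z2 n e.
Definition zeta1 : expo -> K := mono 0 0 1 0.
Definition zeta2 : expo -> K := mono 0 0 0 1.

Definition z12 : expo -> K := fun e => z1 1 e - z2 1 e.

Definition theta12 : expo -> K := fun e =>
  zeta1 e - \sum_(n \in [set n : nat | (0 < n)%N])
              n%:R^-1 * mono (- n%:Z) n%:Z 0 0 e.
Definition theta21 : expo -> K := fun e =>
  zeta2 e - \sum_(n \in [set n : nat | (0 < n)%N])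
              n%:R^-1 * mono n%:Z (- n%:Z) 0 0 e.

Definition iota_inv_z12 : expo -> K := fun e =>
  \sum_(j \in [set: nat]) mono (- j%:Z - 1) j%:Z 0 0 e.
Definition iota_z12 (n : int) : expo -> K :=
  match n with
  | Posz m => spow z12 m
  | Negz m => spow iota_inv_z12 m.+1
  end.

(* e^(θ A) x, for A locally nilpotent. *)
Definition sexp {U : lmodType K} (theta : expo -> K) (A : U -> U) (x : U)
  : expo -> U :=
  fun e => \sum_(k \in [set: nat]) ((k`!)%:R^-1 * spow theta k e) *: iter k A x.

End Series.

Section LogFields.
Context {K : numFieldType} {V : lmodType K}.

(* [f n k] is the coefficient of z^n ζ^k; this is membership in V((z))[ζ]. *)
Definition log_laurent (f : int -> nat -> V) : Prop :=
  exists (m : int) (l : nat), forall n k, f n k != 0 -> (m <= n) /\ (k < l)%N.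

(* D_z = ∂_z + z^-1 ∂_ζ *)
Definition Dz (f : int -> nat -> V) : int -> nat -> V :=
  fun n k => (n + 1)%:~R *: f (n + 1) k + k.+1%:R *: f (n + 1) k.+1.

Variable Y : V -> V -> int -> nat -> V.

Definition Ycoef (n : int) (k : nat) : tensor V V -> V :=
  tlift (fun a b => Y a b n k).

(* Y with z^n replaced by [zn n] and ζ by [zeta]. *)
Definition Ysubst (zn : int -> expo -> K) (zeta : expo -> K)
  : tensor V V -> expo -> V :=
  fun x e => \sum_(p \in [set: int * nat])
    smul (zn p.1) (spow zeta p.2) e *: Ycoef p.1 p.2 x.

End LogFields.

Section TensorFields.
Context {K : numFieldType} {V : lmodType K}.

Definition id_tens (F : tensor V V -> expo -> V)
  : tensor V (tensor V V) -> expo -> tensor V V :=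
  fun x e => tmap id (F ^~ e) x.

Definition tens_id (F : tensor V V -> expo -> V)
  : tensor V (tensor V V) -> expo -> tensor V V :=
  fun x e => tmap (F ^~ e) id (tassocV x).

End TensorFields.

Record logVA (K : numFieldType) := LogVA {
  lva_space :> superspace K;
  vac : lva_space;
  transl : {linear lva_space -> lva_space};
  (* [Yop a b n k] is the coefficient of z^n ζ^k in Y(a, z) b *)
  Yop : lva_space -> lva_space -> int -> nat -> lva_space;
  braid : {linear tensor lva_space lva_space -> tensor lva_space lva_space};
  vac_even : homog false vac;
  transl_even : even_fun transl;
  Yop_bilinear : forall n k, bilinear_for *:%R *:%R (fun a b => Yop a b n k);
  Yop_log : forall a b, log_laurent (Yop a b);
  Yop_even : forall i j a b, homog i a -> homog j b ->
    forall n k, homog (i (+) j) (Yop a b n k);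
  braid_braiding : braiding_map braid;
  vacuum_id : forall b n k,
    Yop vac b n k = if (n == 0) && (k == 0%N) then b else 0;
  vacuum_creation : forall a n k,
    (n < 0) || (0 < k)%N -> Yop a vac n k = 0;
  vacuum_value : forall a, Yop a vac 0 0%N = a;
  transl_vac : transl vac = 0;
  covariance : forall a b n k,
    transl (Yop a b n k) - Yop a (transl b) n k = Dz (Yop a b) n k;
  braid_nilp : forall x, exists n, iter n braid x = 0;
  locality : forall i j a b, homog i a -> homog j b ->
    exists N : nat, forall c,
      sapply (Ysubst Yop z1 zeta1)
        (sapply (id_tens (Ysubst Yop z2 zeta2))
          (sscale (spow z12 N) (sexp theta12 (on12 braid) (a ⊗ (b ⊗ c)))))
      = fun e => (-1) ^+ (i && j) *:
        sapply (Ysubst Yop z2 zeta2)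
          (sapply (id_tens (Ysubst Yop z1 zeta1))
            (sscale (spow z12 N) (sexp theta21 (on12 braid) (b ⊗ (a ⊗ c))))) e;
  hexagon : forall n k x,
    braid (tmap (Ycoef Yop n k) id (tassocV x))
    = tmap (Ycoef Yop n k) id (tassocV (on13 braid x + on23 braid x)) }.

(* Main.v *)
From HB Require Import structures.
Require Import Defs.
From mathcomp Require Import all_boot all_order all_algebra.
From mathcomp Require Import boolp classical_sets fsbigop reals complex.
From mathcomp Require Import zify.

(** Write E for e^(-z2 T), Y12 for the field with z replaced by z12, and P for
    the flip. Locality applied to a triple (a, b, vacuum) is an identity of two
    power series in z1, z2, which are independent of ζ1, ζ2 and killed by
    ∂1 + ∂2 - T; comparing their restrictions to z2 = 0 and to z1 = 0 gives
    the skew_symmetry-symmetry Y(z,ζ) P = e^(zT) Y(-z,ζ).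

    Skew-symmetry in the last two factors and the Taylor formula
    Y(z12) (I ⊗ E) = E Y(z1) turn the left-hand side of associativity into E
    applied to the left-hand side of locality for (a, c, b). Locality
    exchanges z1 and z2, and a second use of skew_symmetry-symmetry, now for the outer
    field, absorbs E and gives the right-hand side.

    The right-hand sides are expanded in the domain |z2| > |z1|. They are
    reduced to series expanded in |z1| > |z2| by swapping the two variables:
    ϑ21 is the swap of ϑ12, and z12 changes sign. *)

Set Implicit Arguments.
Unset Strict Implicit.
Unset Printing Implicit Defensive.

Import Order.TTheory GRing.Theory Num.Theory.
Local Open Scope ring_scope.

(** * Convolution sums *)

(** A finitely supported sum is 0 by default when its support is infinite, so every exchange of
    convolutions needs a finiteness witness. All series are therefore kept in a class of supports
    closed under products, with the variant [jpred] for fields applied to series.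

    The restrictions to z2 = 0 and z1 = 0 can be compared because the vacuum axiom removes ζ2 and
    negative powers of z2 from one side of locality, and ζ1 and negative powers of z1 from the
    other. The absence of ζ1 also forces Y(z, ζ) = Y(z, 0) e^(-ζ S). Skew-symmetry thus reduces to ζ
    = 0, since S commutes with P.

    The factors z12^N and the powers of ϑ12 are scalar series and pass through the fields and
    through E. The flip of the last two factors conjugates S13 into S12, so the exponential of
    associativity becomes that of locality, and the N of locality for the flipped tensor serves
    unchanged. *)

Lemma expoDE (a b : expo) : a + b =
  (a.1.1 + b.1.1, a.1.2 + b.1.2, ((a.2.1 + b.2.1)%N, (a.2.2 + b.2.2)%N)).
Proof. by []. Qed.

Lemma expo_box (B : nat) : exists2 r : seq expo, uniq r & forall x : expo,
  - B%:Z <= x.1.1 <= B%:Z -> - B%:Z <= x.1.2 <= B%:Z ->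
  (x.2.1 <= B)%N -> (x.2.2 <= B)%N -> x \in r.
Proof.
pose ri : seq int := [seq n%:Z - B%:Z | n <- iota 0 (B + B).+1].
pose rn := iota 0 B.+1.
have riP (i : int) : - B%:Z <= i <= B%:Z -> i \in ri.
  move=> h; apply/mapP; exists (absz (i + B%:Z)); last by lia.
  by rewrite mem_iota; lia.
have rnP k : (k <= B)%N -> k \in rn by rewrite mem_iota.
move: ri rn riP rnP => ri rn riP rnP.
pose r : seq expo := [seq (x, y) | x <- [seq (i, j) | i <- ri, j <- ri],
                                   y <- [seq (k, l) | k <- rn, l <- rn]].
exists (undup r).
  exact: undup_uniq.
move=> x; rewrite mem_undup; case: x => [[i j] [k l]] hi hj hk hl.
apply/allpairsP; exists ((i, j), (k, l)); split=> //=; apply/allpairsP.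
  by exists (i, j); rewrite !riP.
by exists (k, l); rewrite !rnP.
Qed.

Section SplitSums.
Variable U : nmodType.
Implicit Types (e : expo) (phi : expo * expo -> U) (h : expo -> expo -> expo -> U).

(** The finiteness witness without which even additivity of the sum over [splits e] could fail. One
    list for both factors keeps the notion symmetric. *)
Definition summable e phi := exists2 r : seq expo, uniq r &
  forall a b, a + b = e -> phi (a, b) != 0 -> a \in r /\ b \in r.

Lemma splits_sum (r1 r2 : seq expo) e phi : uniq r1 -> uniq r2 ->
  (forall a b, a + b = e -> phi (a, b) != 0 -> a \in r1 /\ b \in r2) ->
  \sum_(p \in splits e) phi p
  = \sum_(a <- r1) \sum_(b <- r2 | a + b == e) phi (a, b).
Proof.
move=> u1 u2 hr.
rewrite (fsbigE [seq p <- [seq (a, b) | a <- r1, b <- r2] | p.1 + p.2 == e]).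
- have -> : \sum_(a <- r1) \sum_(b <- r2 | a + b == e) phi (a, b)
      = \sum_(p <- [seq (a, b) | a <- r1, b <- r2] | p.1 + p.2 == e) phi p.
    rewrite [RHS]big_mkcond big_allpairs.
    by apply: eq_bigr => a _; rewrite [LHS]big_mkcond; apply: eq_bigr.
  rewrite -[RHS]big_filter [LHS]big_mkcond [LHS]big_seq [RHS]big_seq.
  apply: eq_bigr => p; rewrite mem_filter => /andP[/eqP hp _].
  by rewrite ifT // inE.
- by apply/filter_uniq/allpairs_uniq => // -[a b] [c d].
- by move=> p /=; rewrite mem_filter => /andP[/eqP].
- move=> [a b] /= hab hn; apply/eqP/negPn/negP => /(hr _ _ hab)[ha hb].
  move/negP: hn; apply; rewrite mem_filter /= hab eqxx.
  by apply/allpairsP; exists (a, b).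
Qed.

Lemma splits_swap e phi :
  \sum_(p \in splits e) phi p = \sum_(p \in splits e) phi (p.2, p.1).
Proof.
apply: (reindex_fsbig (fun p : expo * expo => (p.2, p.1))).
split=> [p /= <-|p q _ _|p /= hp]; first by rewrite /splits /= addrC.
  by case: p q => [a b] [c d] [-> ->].
by exists (p.2, p.1); rewrite /splits /= ?(addrC p.2) //; case: p hp.
Qed.

Lemma splits_sumD e phi psi : summable e phi -> summable e psi ->
  \sum_(p \in splits e) (phi p + psi p)
  = \sum_(p \in splits e) phi p + \sum_(p \in splits e) psi p.
Proof.
move=> [r u hr] [s v hs]; have w := undup_uniq (r ++ s).
have in_r a : a \in r -> a \in undup (r ++ s) by rewrite mem_undup mem_cat => ->.
have in_s a : a \in s -> a \in undup (r ++ s).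
  by rewrite mem_undup mem_cat orbC => ->.
rewrite !(splits_sum w w).
- by rewrite -big_split; apply: eq_bigr => a _; rewrite -big_split.
- by move=> a b hab /(hs _ _ hab)[/in_s ? /in_s].
- by move=> a b hab /(hr _ _ hab)[/in_r ? /in_r].
- move=> a b hab; have [->|/(hr _ _ hab)[/in_r ? /in_r]//] := eqVneq (phi (a, b)) 0.
  by rewrite add0r => /(hs _ _ hab)[/in_s ? /in_s].
Qed.


Definition summable3 e h := exists2 r : seq expo, uniq r &
  forall a b c, a + (b + c) = e -> h a b c != 0 -> [/\ a \in r, b \in r & c \in r].

(** Flattening to one finite triple sum turns associativity and commutativity of convolution into
    exchanges of finite sums. *)
Lemma splits_sum3 e h r : uniq r ->
  (forall a b c, a + (b + c) = e -> h a b c != 0 -> [/\ a \in r, b \in r & c \in r]) ->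
  \sum_(p \in splits e) \sum_(q \in splits p.2) h p.1 q.1 q.2
  = \sum_(a <- r) \sum_(b <- r) \sum_(c <- r | a + (b + c) == e) h a b c.
Proof.
move=> u hr; pose r2 := undup [seq b + c | b <- r, c <- r].
rewrite (splits_sum u (undup_uniq [seq b + c | b <- r, c <- r])); last first.
  move=> a s has /(@fsbigN1 _ _ _ _ _ _ (fun p q => h p.1 q.1 q.2) (a, s)).
  case=> -[b c] /= hbc hn.
  have [|ha hb hc] := hr a b c _ hn; first by rewrite hbc.
  by split=> //; rewrite mem_undup -hbc; apply/allpairsP; exists (b, c).
apply: eq_bigr => a _.
under eq_bigr => s /eqP has.
  rewrite (splits_sum u u); last by move=> b c hbc /= /hr[]//; rewrite hbc.
  over.
rewrite exchange_big /=; apply: eq_bigr => b _.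
rewrite (exchange_big_dep xpredT) //= [RHS]big_mkcond /=.
apply: eq_big_seq => c hc; case: eqP => [habc|habc]; last first.
  by rewrite big1 // => s /andP[/eqP h1 /eqP h2]; case: habc; rewrite h2.
have [hb|hb] := boolP (b \in r); last first.
  rewrite (_ : h a b c = 0) ?big1 //; apply/eqP/negPn/negP => /hr[]// _.
  by move/negP: hb.
rewrite big_mkcond (bigD1_seq (b + c)) ?undup_uniq //=.
- rewrite habc !eqxx /= big1 ?addr0 // => s hs; case: ifP => // /andP[_ /eqP hbc].
  by rewrite hbc eqxx in hs.
- by rewrite mem_undup; apply/allpairsP; exists (b, c).
Qed.

Lemma splits_sumA e h : summable3 e h ->
  \sum_(p \in splits e) \sum_(q \in splits p.2) h p.1 q.1 q.2
  = \sum_(p \in splits e) \sum_(q \in splits p.1) h q.1 q.2 p.2.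
Proof.
move=> [r u hr]; rewrite [RHS]splits_swap /= (splits_sum3 u hr).
rewrite (@splits_sum3 e (fun c a b => h a b c) r) //; last first.
  by move=> c a b habc /hr[|]//; rewrite addrA addrC.
under eq_bigr do under eq_bigr do rewrite big_mkcond.
under [RHS]eq_bigr do under eq_bigr do rewrite big_mkcond.
rewrite [RHS]exchange_big; apply: eq_bigr => a _; rewrite [RHS]exchange_big.
by do 2!apply: eq_bigr => ? _; rewrite [in RHS]addrC addrA.
Qed.

Lemma splits_sumAC e h : summable3 e h ->
  \sum_(p \in splits e) \sum_(q \in splits p.2) h p.1 q.1 q.2
  = \sum_(p \in splits e) \sum_(q \in splits p.2) h q.1 p.1 q.2.
Proof.
move=> [r u hr]; rewrite (splits_sum3 u hr).
rewrite (@splits_sum3 e (fun b a c => h a b c) r) //; last first.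
  by move=> b a c habc /hr[|]//; rewrite addrCA.
rewrite [RHS]exchange_big; do 2!apply: eq_bigr => ? _.
by apply: eq_bigl => c; rewrite addrCA.
Qed.

Lemma splits_bigsum (K : nat) e (phi : nat -> expo * expo -> U) :
  (forall k, summable e (phi k)) ->
  \sum_(p \in splits e) \sum_(k < K) phi k p
  = \sum_(k < K) \sum_(p \in splits e) phi k p.
Proof.
(* The induction must also carry summability of the partial sums, which additivity requires at the
   next step. *)
move=> hphi; suff [] : summable e (fun p => \sum_(k < K) phi k p) /\
   \sum_(p \in splits e) \sum_(k < K) phi k p
  = \sum_(k < K) \sum_(p \in splits e) phi k p by [].
elim: K => [|K [IHs IHK]].
  split; last by rewrite big_ord0; apply: fsbig1 => p _; rewrite big_ord0.
  by exists [::] => // a b _; rewrite big_ord0 eqxx.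
split.
  have [r u hr] := IHs; have [s v hs] := hphi K.
  exists (undup (r ++ s)) => [|a b hab]; first exact: undup_uniq.
  rewrite big_ord_recr /= !mem_undup !mem_cat.
  have [->|/(hr _ _ hab)[-> ->]//] := eqVneq (\sum_(k < K) phi k (a, b)) 0.
  by rewrite add0r => /(hs _ _ hab)[-> ->]; rewrite !orbT.
rewrite [RHS]big_ord_recr /= -IHK -splits_sumD //.
by apply: eq_fsbigr => p _; rewrite big_ord_recr.
Qed.

End SplitSums.

Lemma splits_additive (U W : nmodType) (f : U -> W) e (phi : expo * expo -> U) :
  f 0 = 0 -> {morph f : x y / x + y} -> summable e phi ->
  f (\sum_(p \in splits e) phi p) = \sum_(p \in splits e) f (phi p).
Proof.
move=> f0 fD [r u hr]; rewrite !(splits_sum u u) //.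
  rewrite (big_morph f fD f0); apply: eq_bigr => a _.
  exact: (big_morph f fD f0).
move=> a b hab h; apply: hr => //.
by apply: contra_neq h => ->.
Qed.

(** * Linear maps and products of series with controlled supports *)

Section Linear.
Context {K : pzRingType} {U W : lmodType K} (f : U -> W).
Hypothesis fl : linear f.

Lemma lin0 : f 0 = 0.
Proof. by have := fl (-1) 0 0; rewrite scaler0 addr0 scaleN1r addNr. Qed.

Lemma linD : {morph f : x y / x + y}.
Proof. by move=> x y; rewrite -[x]scale1r fl !scale1r. Qed.

Lemma linZ c x : f (c *: x) = c *: f x.
Proof. by rewrite -[c *: x]addr0 fl lin0 addr0. Qed.

Lemma lin_sum I (r : seq I) P (F : I -> U) :
  f (\sum_(i <- r | P i) F i) = \sum_(i <- r | P i) f (F i).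
Proof. exact: (big_morph f linD lin0). Qed.

End Linear.

Lemma fsum_nat (U : nmodType) (K : nat) (F : nat -> U) :
  (forall k, (K <= k)%N -> F k = 0) -> \sum_(k \in [set: nat]) F k = \sum_(k < K) F k.
Proof.
move=> hF; rewrite (fsbigE (iota 0 K)) ?iota_uniq //.
  rewrite -(big_mkord xpredT) /index_iota subn0 big_mkcond /=.
  by apply: eq_bigr => k _; rewrite in_setT.
by move=> k _; rewrite mem_iota add0n -leqNgt => /hF.
Qed.

(** * Supports of iterated Laurent series *)

Section Supports.

(* The exponents of a series in the iterated Laurent series ring
   U((z1))((z2))[[ζ1, ζ2]], in which all products exist. *)
Definition lpred (A : expo -> Prop) := exists m : int, forall v : int,
  exists n : int, forall e, A e -> m <= e.1.2 /\ (e.1.2 <= v -> n <= e.1.1).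

(** The version for pairs that need not form a product set: in [F (w b) a] the exponents [a] that
    occur depend on the vector [w b], so no bound on F alone is available. *)
Definition jpred (J : expo -> expo -> Prop) := exists m : int, forall v : int,
  exists n : int, forall a b, J a b ->
    [/\ m <= a.1.2, m <= b.1.2 & a.1.2 + b.1.2 <= v -> n <= a.1.1 /\ n <= b.1.1].

Definition lsupp (U : nmodType) (f : expo -> U) := lpred (fun e => f e != 0).

Lemma lpred_sub (A B : expo -> Prop) :
  (forall e, A e -> B e) -> lpred B -> lpred A.
Proof.
move=> h [m hm]; exists m => v; have [n hn] := hm v.
by exists n => e /h/hn.
Qed.

Lemma jpred_sub (A B : expo -> expo -> Prop) :
  (forall a b, A a b -> B a b) -> jpred B -> jpred A.
Proof.
move=> h [m hm]; exists m => v; have [n hn] := hm v.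
by exists n => a b /h/hn.
Qed.

Lemma jpred_prod A B : lpred A -> lpred B -> jpred (fun a b => A a /\ B b).
Proof.
move=> [m hm] [m' hm']; exists (Num.min m m') => v.
have [n hn] := hm (v - m'); have [n' hn'] := hm' (v - m).
by exists (Num.min n n') => a b [/hn h1 /hn' h2]; split; lia.
Qed.

Lemma jpred_conv J : jpred J -> lpred (fun e => exists a b, a + b = e /\ J a b).
Proof.
move=> [m hm]; exists (m + m) => v; have [n hn] := hm v.
by exists (n + n) => e [a [b [<- /hn[*]]]]; rewrite expoDE /=; lia.
Qed.

(** Multiplying the inner series by a scalar series with support in [A] replaces c by b + c; the
    joint bound survives. *)
Lemma jpred_convr A J : lpred A -> jpred J ->
  jpred (fun a s => exists b c, [/\ b + c = s, A b & J a c]).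
Proof.
move=> [m hm] [m' hm']; exists (Num.min m' (m + m')) => v.
have [n hn] := hm (v - m' - m'); have [n' hn'] := hm' (v - m).
exists (Num.min n' (n + n')) => a s [b [c [<- /hn h1 /hn'[*]]]].
by rewrite expoDE /=; split; lia.
Qed.

Lemma jpred_summable (U : nmodType) J e (phi : expo * expo -> U) : jpred J ->
  (forall a b, a + b = e -> phi (a, b) != 0 -> J a b) -> summable e phi.
Proof.
move=> [m hm] h; have [n hn] := hm e.1.2.
have [r u hr] := expo_box (`|m| + `|n| + `|e.1.1| + `|e.1.2| + e.2.1 + e.2.2)%N.
exists r => // a b; move: (h a b); case: e hn {h} hr => [[i j] [k l]] hn hr h hab.
move=> /(h hab)/hn; case: a b hab {h hn} => [[i1 j1] [k1 l1]] [[i2 j2] [k2 l2]].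
by rewrite expoDE /= => -[? ? ? ?] [*]; split; apply: hr => /=; lia.
Qed.

Lemma jpred_summable3 (U : nmodType) A J e (h : expo -> expo -> expo -> U) :
  lpred A -> jpred J ->
  (forall a b c, h a b c != 0 -> A b /\ J a c) -> summable3 e h.
Proof.
move=> [m hm] [m' hm'] H.
have [n hn] := hm (e.1.2 - m' - m'); have [n' hn'] := hm' (e.1.2 - m).
have [r u hr] := expo_box (`|m| + `|n| + `|m'| + `|m'| + `|n'| + `|n'|
   + `|e.1.1| + `|e.1.2| + e.2.1 + e.2.2)%N.
exists r => // a b c habc; move=> /H[/hn + /hn'].
case: e a b c habc hr {hn hn'} => [[i j] [k l]] [[i1 j1] [k1 l1]] [[i2 j2] [k2 l2]].
case=> [[i3 j3] [k3 l3]]; rewrite !expoDE /= => -[? ? ? ?] hr ? [*].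
by split; apply: hr => /=; lia.
Qed.

End Supports.

Section SeriesProducts.
Context {K : numFieldType}.
Implicit Types (U W : lmodType K) (f g h : expo -> K).

Lemma lsuppD U (w v : expo -> U) : lsupp w -> lsupp v -> lsupp (fun e => w e + v e).
Proof.
move=> [m hm] [m' hm']; exists (Num.min m m') => x.
have [n hn] := hm x; have [n' hn'] := hm' x; exists (Num.min n n') => e.
have [->|/hn h _] := eqVneq (w e) 0; last by lia.
by rewrite add0r => /hn'; lia.
Qed.

Lemma lsupp_sscale U f (w : expo -> U) : lsupp f -> lsupp w -> lsupp (sscale f w).
Proof.
move=> hf hw; apply: lpred_sub (jpred_conv (jpred_prod hf hw)) => e.
move=> /(@fsbigN1 _ _ _ _ _ _ (fun _ p => f p.1 *: w p.2) tt)[[a b] /= hab].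
by rewrite scaler_eq0 negb_or => /andP[ha hb]; exists a, b.
Qed.

Lemma lsupp_smul f g : lsupp f -> lsupp g -> lsupp (smul f g).
Proof. exact: (@lsupp_sscale K^o). Qed.

Lemma summable_sscale U f (w : expo -> U) e : lsupp f -> lsupp w ->
  summable e (fun p => f p.1 *: w p.2).
Proof.
move=> hf hw; apply: jpred_summable (jpred_prod hf hw) _ => a b _ /=.
by rewrite scaler_eq0 negb_or => /andP[].
Qed.

Lemma sscaleA U f g (w : expo -> U) : lsupp f -> lsupp g -> lsupp w ->
  sscale f (sscale g w) = sscale (smul f g) w.
Proof.
move=> hf hg hw; apply/funext => e.
transitivity (\sum_(p \in splits e) \sum_(q \in splits p.2)
    (f p.1 * g q.1) *: w q.2).
  apply: eq_fsbigr => p _; rewrite /sscale.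
  rewrite (splits_additive (scaler0 _ _) (scalerDr _)); last first.
    exact: summable_sscale.
  by apply: eq_fsbigr => q _; rewrite scalerA.
rewrite (@splits_sumA _ _ (fun a b c => (f a * g b) *: w c)).
  apply: eq_fsbigr => p _; rewrite -[RHS]/((fun c => c *: w p.2) (smul f g p.1)).
  have sD : {morph (fun c : K^o => c *: w p.2) : c d / c + d}.
    by move=> c d; rewrite scalerDl.
  have s0 : (fun c : K^o => c *: w p.2) 0 = 0 by rewrite scale0r.
  rewrite (@splits_additive K^o U _ _ _ s0 sD) //.
  exact: (@summable_sscale K^o).
apply: jpred_summable3 hg (jpred_prod hf hw) _ => a b c.
by rewrite scaler_eq0 mulf_eq0 !negb_or => /andP[/andP[]].
Qed.

Lemma smulA f g h : lsupp f -> lsupp g -> lsupp h ->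
  smul f (smul g h) = smul (smul f g) h.
Proof. exact: (@sscaleA K^o). Qed.

Lemma smulC f g : smul f g = smul g f.
Proof.
apply/funext => e; rewrite /smul splits_swap /=.
by apply: eq_fsbigr => p _; rewrite mulrC.
Qed.

Lemma sscale_lin U W (F : U -> W) f (w : expo -> U) : linear F ->
  lsupp f -> lsupp w -> sscale f (F \o w) = F \o sscale f w.
Proof.
move=> Fl hf hw; apply/funext => e /=.
rewrite [in RHS]/sscale (splits_additive (lin0 Fl) (linD Fl)).
  by apply: eq_fsbigr => p _; rewrite linZ.
exact: summable_sscale.
Qed.

Lemma sscaleDl U f g (w : expo -> U) e : lsupp f -> lsupp g -> lsupp w ->
  sscale (fun e => f e + g e) w e = sscale f w e + sscale g w e.
Proof.
move=> hf hg hw; rewrite /sscale.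
under eq_fsbigr do rewrite scalerDl.
by rewrite splits_sumD //; apply: summable_sscale.
Qed.

Lemma sscaleDr U f (w v : expo -> U) e : lsupp f -> lsupp w -> lsupp v ->
  sscale f (fun e => w e + v e) e = sscale f w e + sscale f v e.
Proof.
move=> hf hw hv; rewrite /sscale.
under eq_fsbigr do rewrite scalerDr.
by rewrite splits_sumD //; apply: summable_sscale.
Qed.

Lemma sscale_sum U f n (w : nat -> expo -> U) : lsupp f ->
  (forall k, lsupp (w k)) ->
  sscale f (fun e => \sum_(k < n) w k e) = fun e => \sum_(k < n) sscale f (w k) e.
Proof.
move=> hf hw; apply/funext => e; rewrite /sscale.
under eq_fsbigr do rewrite scaler_sumr.
rewrite (@splits_bigsum _ n e (fun k p => f p.1 *: w k p.2)) // => k.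
exact: summable_sscale.
Qed.

Lemma sscaleZr U f c (w : expo -> U) e : lsupp f -> lsupp w ->
  sscale f (fun e => c *: w e) e = c *: sscale f w e.
Proof.
move=> hf hw.
have cl : linear (fun v : U => c *: v).
  by move=> d x y; rewrite scalerDr !scalerA mulrC.
have /(congr1 (fun g : expo -> U => g e)) := sscale_lin cl hf hw; exact.
Qed.

Section Apply.
Context {U W : lmodType K} (F : U -> expo -> W).
Hypothesis Fl : forall e, linear (F ^~ e).

Lemma lsupp_sapply (w : expo -> U) :
  jpred (fun a b => F (w b) a != 0) -> lsupp (sapply F w).
Proof.
move=> hJ; apply: lpred_sub (jpred_conv hJ) => e.
move=> /(@fsbigN1 _ _ _ _ _ _ (fun _ p => F (w p.2) p.1) tt)[[a b] /= hab].
by exists a, b.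
Qed.

(** This is what lets z12^N and the powers of ϑ12 leave the fields: the coefficients of [F] are
    linear, and the joint bound permits the exchange of the two convolutions. *)
Lemma sapply_sscale f (w : expo -> U) : lsupp f -> lsupp w ->
  jpred (fun a b => F (w b) a != 0) ->
  sapply F (sscale f w) = sscale f (sapply F w).
Proof.
move=> hf hw hJ; apply/funext => e.
transitivity (\sum_(p \in splits e) \sum_(q \in splits p.2)
    f q.1 *: F (w q.2) p.1).
  apply: eq_fsbigr => p _; rewrite /sscale.
  rewrite (splits_additive (lin0 (Fl _)) (linD (Fl _))); last first.
    exact: summable_sscale.
  by apply: eq_fsbigr => q _; rewrite (linZ (Fl _)).
rewrite (@splits_sumAC _ _ (fun a b c => f b *: F (w c) a)).
  apply: eq_fsbigr => p _; rewrite /sapply.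
  rewrite (splits_additive (scaler0 _ _) (scalerDr _)) //.
  by apply: jpred_summable hJ _.
apply: jpred_summable3 hf hJ _ => a b c.
by rewrite scaler_eq0 negb_or => /andP[].
Qed.

Lemma jpred_sscale f (w : expo -> U) : lsupp f -> lsupp w ->
  jpred (fun a b => F (w b) a != 0) -> jpred (fun a b => F (sscale f w b) a != 0).
Proof.
move=> hf hw hJ; apply: jpred_sub (jpred_convr hf hJ) => a s.
rewrite /sscale (splits_additive (lin0 (Fl _)) (linD (Fl _))); last first.
  exact: summable_sscale.
move=> /(@fsbigN1 _ _ _ _ _ _ (fun _ q => F (f q.1 *: w q.2) a) tt)[[b c] /= hbc].
rewrite (linZ (Fl _)) scaler_eq0 negb_or => /andP[hb hc].
by exists b, c.
Qed.

Lemma sapply_sum n (w : nat -> expo -> U) :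
  (forall k, jpred (fun a b => F (w k b) a != 0)) ->
  sapply F (fun e => \sum_(k < n) w k e)
  = fun e => \sum_(k < n) sapply F (w k) e.
Proof.
move=> hw; apply/funext => e; rewrite /sapply.
rewrite -(@splits_bigsum _ n e (fun k p => F (w k p.2) p.1)).
  by apply: eq_fsbigr => p _; rewrite (lin_sum (Fl _)).
by move=> k; apply: jpred_summable (hw k) _.
Qed.

Lemma sapplyZ c (w : expo -> U) : jpred (fun a b => F (w b) a != 0) ->
  sapply F (fun e => c *: w e) = fun e => c *: sapply F w e.
Proof.
move=> hw; apply/funext => e; rewrite /sapply.
rewrite (splits_additive (scaler0 _ _) (scalerDr _)) //.
  by apply: eq_fsbigr => p _; rewrite (linZ (Fl _)).
by apply: jpred_summable hw _.
Qed.

End Apply.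

End SeriesProducts.

(** * Tensor products of superspaces *)

Section Tensors.
Context {K : fieldType}.
Implicit Types U V W : lmodType K.

Lemma tens_ind V W (P : tensor V W -> Prop) : P 0 ->
  (forall s t, P s -> P t -> P (s + t)) -> (forall x w, P (x ⊗ w)) ->
  forall t, P t.
Proof.
move=> P0 PD Pt t; rewrite (tensE t); elim: (repr t) => [|p s IHs].
  by rewrite big_nil.
by rewrite big_cons; apply: PD.
Qed.

Lemma tens_linl V W (w : W) : linear (fun x : V => x ⊗ w).
Proof. by move=> c x y; rewrite tens_bilinear.1. Qed.

Lemma tens_linr V W (x : V) : linear (fun w : W => x ⊗ w).
Proof. by move=> c w u; rewrite tens_bilinear.2. Qed.

Lemma tens_ext U V W (f g : tensor V W -> U) : linear f -> linear g ->
  (forall x w, f (x ⊗ w) = g (x ⊗ w)) -> f =1 g.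
Proof.
move=> fl gl h; apply: tens_ind => [|s t hs ht|]; last exact: h.
  by rewrite (lin0 fl) (lin0 gl).
by rewrite (linD fl) (linD gl) hs ht.
Qed.

Lemma comp_lin U V W (f : V -> W) (g : U -> V) :
  linear f -> linear g -> linear (f \o g).
Proof. by move=> fl gl c x y /=; rewrite gl fl. Qed.

Lemma scale_add_lin U V c (f g : U -> V) :
  linear f -> linear g -> linear (fun x => c *: f x + g x).
Proof.
move=> fl gl a x y; rewrite fl gl !scalerDr !scalerA [c * a]mulrC.
by rewrite -!addrA; congr (_ + _); rewrite addrCA.
Qed.

Lemma scale_lin U V c (f : U -> V) : linear f -> linear (fun x => c *: f x).
Proof. by move=> fl a x y; rewrite fl scalerDr !scalerA mulrC. Qed.

Lemma sum_lin U V (I : finType) (f : I -> U -> V) :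
  (forall i, linear (f i)) -> linear (fun x => \sum_i f i x).
Proof.
move=> fl a x y; rewrite scaler_sumr -big_split.
by apply: eq_bigr => i _; rewrite fl.
Qed.

Lemma id_lin U : linear (@idfun U).
Proof. by []. Qed.

Section Tmap.
Context {U U' V V' : lmodType K} (f : U -> U') (g : V -> V').
Hypotheses (fl : linear f) (gl : linear g).

Lemma tmap_bilinear : bilinear_for *:%R *:%R (fun u v => f u ⊗ g v).
Proof.
by split=> [v|u] c x y /=; rewrite ?fl ?gl ?tens_bilinear.1 ?tens_bilinear.2.
Qed.

Lemma tmap_lin : linear (tmap f g).
Proof. exact: tlift_linear tmap_bilinear. Qed.

Lemma tmap_tens u v : tmap f g (u ⊗ v) = f u ⊗ g v.
Proof. exact: tlift_tens tmap_bilinear _ _. Qed.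

End Tmap.

Lemma tmap_comp U U' U'' V V' V'' (f : U' -> U'') (g : V' -> V'')
    (f' : U -> U') (g' : V -> V') :
  linear f -> linear g -> linear f' -> linear g' ->
  forall t, tmap f g (tmap f' g' t) = tmap (f \o f') (g \o g') t.
Proof.
move=> fl gl fl' gl'; apply: tens_ext.
- by apply: comp_lin; exact: tmap_lin.
- by apply: tmap_lin; exact: comp_lin.
- by move=> x w; rewrite !tmap_tens //; exact: comp_lin.
Qed.

Lemma tmap_id U V (t : tensor U V) : tmap id id t = t.
Proof.
move: t; apply: tens_ext => //; first exact: tmap_lin.
by move=> x w; rewrite tmap_tens.
Qed.

Section Assoc.
Context {U V W : lmodType K}.

Lemma tassoc_bil (w : W) : bilinear_for *:%R *:%R (fun (u : U) (v : V) => u ⊗ (v ⊗ w)).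
Proof.
by split=> [v|u] c x y /=; rewrite ?tens_bilinear.1 ?tens_bilinear.2.
Qed.

Lemma tassoc_bilinear : bilinear_for *:%R *:%R
  (fun x (w : W) => tlift (fun (u : U) (v : V) => u ⊗ (v ⊗ w)) x).
Proof.
split=> [w|x] c y z; first by rewrite (tlift_linear (tassoc_bil w)).
move: x; apply: tens_ext.
- exact: tlift_linear (tassoc_bil _).
- by apply: scale_add_lin; exact: tlift_linear (tassoc_bil _).
by move=> u v; rewrite !tlift_tens ?tens_bilinear.2 //; apply: tassoc_bil.
Qed.

Lemma tassoc_lin : linear (@tassoc _ U V W).
Proof. exact: tlift_linear tassoc_bilinear. Qed.

Lemma tassocE u v w : @tassoc _ U V W ((u ⊗ v) ⊗ w) = u ⊗ (v ⊗ w).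
Proof.
by rewrite /tassoc (tlift_tens tassoc_bilinear) (tlift_tens (tassoc_bil w)).
Qed.

Lemma tassocV_bil (u : U) : bilinear_for *:%R *:%R (fun (v : V) (w : W) => (u ⊗ v) ⊗ w).
Proof.
by split=> [v|w] c x y /=; rewrite ?tens_bilinear.2 ?tens_bilinear.1.
Qed.

Lemma tassocV_bilinear : bilinear_for *:%R *:%R
  (fun u x => tlift (fun (v : V) (w : W) => ((u : U) ⊗ v) ⊗ w) x).
Proof.
split=> [x|u] c y z; last by rewrite (tlift_linear (tassocV_bil u)).
move: x; apply: tens_ext.
- exact: tlift_linear (tassocV_bil _).
- by apply: scale_add_lin; exact: tlift_linear (tassocV_bil _).
by move=> v w; rewrite !tlift_tens ?tens_bilinear.1 //; apply: tassocV_bil.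
Qed.

Lemma tassocV_lin : linear (@tassocV _ U V W).
Proof. exact: tlift_linear tassocV_bilinear. Qed.

Lemma tassocVE u v w : @tassocV _ U V W (u ⊗ (v ⊗ w)) = (u ⊗ v) ⊗ w.
Proof.
by rewrite /tassocV (tlift_tens tassocV_bilinear) (tlift_tens (tassocV_bil u)).
Qed.

Lemma tens3_ind (P : tensor U (tensor V W) -> Prop) : P 0 ->
  (forall s t, P s -> P t -> P (s + t)) -> (forall u v w, P (u ⊗ (v ⊗ w))) ->
  forall t, P t.
Proof.
move=> P0 PD Pt; apply: tens_ind => // u; apply: tens_ind => // [|s t hs ht].
  by rewrite (lin0 (tens_linr u)).
by rewrite (linD (tens_linr u)); apply: PD.
Qed.

Lemma tens3_ext (T : lmodType K) (f g : tensor U (tensor V W) -> T) : linear f -> linear g ->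
  (forall u v w, f (u ⊗ (v ⊗ w)) = g (u ⊗ (v ⊗ w))) -> f =1 g.
Proof.
move=> fl gl h; apply: tens3_ind => [|s t hs ht|]; last exact: h.
  by rewrite (lin0 fl) (lin0 gl).
by rewrite (linD fl) (linD gl) hs ht.
Qed.

End Assoc.

Lemma tassocK U V W : cancel (@tassoc K U V W) tassocV.
Proof.
apply: tens_ext => //; first exact: comp_lin tassocV_lin tassoc_lin.
move=> x w; move: x; apply: tens_ext.
- apply: comp_lin (comp_lin tassocV_lin tassoc_lin) _; exact: tens_linl.
- exact: tens_linl.
by move=> u v; rewrite tassocE tassocVE.
Qed.

Lemma tassocVK U V W : cancel (@tassocV K U V W) tassoc.
Proof.
apply: tens3_ext => //; first exact: comp_lin tassoc_lin tassocV_lin.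
by move=> u v w; rewrite tassocVE tassocE.
Qed.

End Tensors.

Section SuperTensors.
Context {K : fieldType} {V : superspace K}.
Implicit Types (i j : bool) (x : tensor V (tensor V V)).

Lemma homog_spart i (v : V) : homog i (spart V i v).
Proof. by rewrite /homog spart_proj eqxx. Qed.

Lemma super_ind (P : V -> Prop) : (forall u v, P u -> P v -> P (u + v)) ->
  (forall i v, homog i v -> P v) -> forall v, P v.
Proof.
move=> PD Ph v; rewrite -(spart_sum v).
by apply: PD; apply: Ph; apply: homog_spart.
Qed.

Lemma homog_spartE i j (v : V) : homog i v -> spart V j v = if j == i then v else 0.
Proof. by move=> hv; rewrite -{1}hv spart_proj hv. Qed.

Lemma flip_bilinear : bilinear_for *:%R *:%R (fun a b : V => \sum_(i : bool) \sum_(j : bool)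
    (-1) ^+ (i && j) *: (spart V j b ⊗ spart V i a)).
Proof.
split=> [b|a]; do 2!apply: sum_lin => ?; apply: scale_lin.
  by apply: (comp_lin (tens_linr _)) => ? ? ?; rewrite linearP.
by apply: (comp_lin (tens_linl _)) => ? ? ?; rewrite linearP.
Qed.

Lemma flip_lin : linear (@super_flip K V).
Proof. exact: tlift_linear flip_bilinear. Qed.

Lemma flip_homog i j (a b : V) : homog i a -> homog j b ->
  super_flip (a ⊗ b) = (-1) ^+ (i && j) *: (b ⊗ a).
Proof.
move=> ha hb; rewrite /super_flip (tlift_tens flip_bilinear) !big_bool /=.
rewrite !(homog_spartE _ ha) !(homog_spartE _ hb).
have tl0 (u : V) : u ⊗ (0 : V) = 0 := lin0 (tens_linr u).
have tr0 (u : V) : (0 : V) ⊗ u = 0 := lin0 (tens_linl u).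
by case: i {ha}; case: j {hb}; rewrite /= ?tl0 ?tr0 ?scaler0 ?addr0 ?add0r.
Qed.

Lemma tens_super_ind (P : tensor V V -> Prop) : P 0 ->
  (forall s t, P s -> P t -> P (s + t)) ->
  (forall i j a b, homog i a -> homog j b -> P (a ⊗ b)) -> forall t, P t.
Proof.
move=> P0 PD Pt; apply: tens_ind => // a b; move: a.
apply: super_ind => [u v hu hv|i a ha].
  by rewrite (linD (tens_linl _)); apply: PD.
move: b; apply: super_ind => [u v hu hv|j b hb]; last exact: Pt ha hb.
by rewrite (linD (tens_linr _)); apply: PD.
Qed.

Lemma tens3_super_ind (P : tensor V (tensor V V) -> Prop) : P 0 ->
  (forall s t, P s -> P t -> P (s + t)) ->
  (forall i j k a b c, homog i a -> homog j b -> homog k c -> P (a ⊗ (b ⊗ c))) ->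
  forall t, P t.
Proof.
move=> P0 PD Pt; apply: tens_ind => // a t; move: a.
apply: super_ind => [u v hu hv|i a ha].
  by rewrite (linD (tens_linl _)); apply: PD.
move: t; apply: tens_super_ind => [|s t hs ht|j k b c hb hc].
- by rewrite (lin0 (tens_linr a)).
- by rewrite (linD (tens_linr a)); apply: PD.
- exact: Pt ha hb hc.
Qed.

Lemma flipK : involutive (@super_flip K V).
Proof.
apply: tens_super_ind => [|s t hs ht|i j a b ha hb].
- by rewrite !(lin0 flip_lin).
- by rewrite !(linD flip_lin) hs ht.
rewrite (flip_homog ha hb) (linZ flip_lin) (flip_homog hb ha) scalerA andbC.
by rewrite -signr_addb addbb scale1r.
Qed.

Section On.
Variable S : tensor V V -> tensor V V.
Hypothesis Sl : linear S.

Lemma on12_lin : linear (on12 S).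
Proof.
exact: comp_lin tassoc_lin (comp_lin (tmap_lin Sl (@id_lin _ V)) tassocV_lin).
Qed.

Lemma on23_lin : linear (on23 S).
Proof. exact: (tmap_lin (@id_lin _ V) Sl). Qed.

Lemma on12E t c : on12 S (tassoc (t ⊗ c)) = tassoc (S t ⊗ c).
Proof. by rewrite /on12 tassocK tmap_tens. Qed.

Lemma on23E a t : on23 S (a ⊗ t) = a ⊗ S t.
Proof. by rewrite /on23 tmap_tens. Qed.

Lemma iter_on12E n t c : iter n (on12 S) (tassoc (t ⊗ c)) = tassoc (iter n S t ⊗ c).
Proof. by elim: n => //= n ->; rewrite on12E. Qed.

Lemma iter_lin (U : lmodType K) (A : U -> U) n : linear A -> linear (iter n A).
Proof. by move=> Al; elim: n => [|n IHn] c x y //=; rewrite IHn Al. Qed.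

Lemma nilp_max (U : lmodType K) (A : U -> U) m n (x : U) : linear A -> (m <= n)%N ->
  iter m A x = 0 -> iter n A x = 0.
Proof.
by move=> Al /subnK <- h; rewrite iterD h (lin0 (iter_lin _ Al)).
Qed.

Lemma on12_nilp : (forall t, exists n, iter n S t = 0) ->
  forall x, exists n, iter n (on12 S) x = 0.
Proof.
move=> nS; apply: tens3_ind => [|s t [n hn] [m hm]|a b c].
- by exists 0%N.
- have il k := iter_lin k on12_lin.
  exists (maxn n m); rewrite (linD (il _)).
  by rewrite !(nilp_max on12_lin _ hn, nilp_max on12_lin _ hm) ?leq_maxl ?leq_maxr ?addr0.
have [n hn] := nS (a ⊗ b); exists n.
rewrite -tassocE iter_on12E hn (lin0 (@tens_linl _ _ _ c)).
exact: lin0 tassoc_lin.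
Qed.

End On.

Lemma on23_flipK : involutive (on23 (@super_flip K V)).
Proof.
move=> x; rewrite /on23 tmap_comp //; try exact: flip_lin.
rewrite -[RHS]tmap_id; congr tmap; apply/funext => t /=; exact: flipK.
Qed.

Lemma on12_flipK : involutive (on12 (@super_flip K V)).
Proof.
move=> x; rewrite /on12 tassocK tmap_comp //; try exact: flip_lin.
rewrite -[RHS]tassocVK -[in RHS](tmap_id (tassocV x)); congr tassoc; congr tmap.
by apply/funext => t /=; exact: flipK.
Qed.

(** S13 is by definition the conjugate of S12 by an involution, hence so are its powers. Through
    this, e^(ϑ S13) becomes e^(ϑ S12) on the flipped tensor. *)
Lemma iter_on13 (S : tensor V V -> tensor V V) n x :
  iter n (on13 S) x = on23 super_flip (iter n (on12 S) (on23 super_flip x)).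
Proof.
elim: n => [|n IHn] /=; first by rewrite on23_flipK.
by rewrite IHn /on13 on23_flipK.
Qed.

Lemma on12_flip_comm (S : tensor V V -> tensor V V) x : linear S ->
  (forall t, S (super_flip t) = super_flip (S t)) ->
  on12 super_flip (on12 S x) = on12 S (on12 super_flip x).
Proof.
move=> Sl h; rewrite /on12 !tassocK !tmap_comp //; try exact: flip_lin.
by congr tassoc; congr tmap; apply/funext => t /=; rewrite h.
Qed.

End SuperTensors.

(** * Exchange of variables and derivations *)

(** A nonzero scalar leaves the support unchanged, so when it is infinite both sums take the default
    value 0 together. *)
Lemma fsum_scale (K : fieldType) (U : lmodType K) (I : choiceType) (A : set I)
    (c : K) (f : I -> U) :
  \sum_(i \in A) c *: f i = c *: \sum_(i \in A) f i.
Proof.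
have [->|c0] := eqVneq c 0.
  by rewrite scale0r; apply: fsbig1 => i _; rewrite scale0r.
have E : (A `&` (fun i => c *: f i) @^-1` [set~ 0] = A `&` f @^-1` [set~ 0])%classic.
  apply/seteqP; split=> i /= [Ai h]; split=> //; move: h; apply: contra_not.
    by move=> ->; rewrite scaler0.
  by move/eqP; rewrite scaler_eq0 (negPf c0) => /eqP.
have -> : finite_support 0 A (fun i => c *: f i) = finite_support 0 A f.
  by rewrite /finite_support E.
by rewrite scaler_sumr.
Qed.

Section Swap.
Context {K : numFieldType}.
Implicit Types (U W : lmodType K) (f g : expo -> K).

Definition sw (e : expo) : expo := (e.1.2, e.1.1, (e.2.2, e.2.1)).

Lemma swK : involutive sw.
Proof. by case=> [[i j] [k l]]. Qed.

Lemma splits_sw (U : nmodType) e (phi : expo * expo -> U) :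
  \sum_(p \in splits (sw e)) phi p = \sum_(p \in splits e) phi (sw p.1, sw p.2).
Proof.
apply: (reindex_fsbig (fun p : expo * expo => (sw p.1, sw p.2))).
split=> [p /= <-//|p q _ _|p /= hp].
  by case: p q => [[[? ?] [? ?]] [[? ?] [? ?]]] [[[? ?] [? ?]] [[? ?] [? ?]]];
    case=> -> -> -> -> -> -> -> ->.
exists (sw p.1, sw p.2); last by case: p hp => a b _ /=; rewrite !swK.
by rewrite /splits /= -[e]swK -hp.
Qed.

Lemma smulZl c f g : smul (fun e => c * f e) g = fun e => c * smul f g e.
Proof.
apply/funext => e; rewrite /smul mulr_fsumr.
by apply: eq_fsbigr => p _; rewrite mulrA.
Qed.

Lemma smulZr c f g : smul f (fun e => c * g e) = fun e => c * smul f g e.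
Proof. by rewrite smulC smulZl; apply/funext => e; rewrite smulC. Qed.

Lemma sscaleZl U c f (w : expo -> U) :
  sscale (fun e => c * f e) w = fun e => c *: sscale f w e.
Proof.
apply/funext => e; rewrite /sscale -fsum_scale.
by apply: eq_fsbigr => p _; rewrite scalerA.
Qed.

Lemma sscale_sw U f (w : expo -> U) :
  sscale (f \o sw) (w \o sw) = sscale f w \o sw.
Proof. by apply/funext => e; rewrite /= /sscale splits_sw. Qed.

Lemma smul_sw f g : smul (f \o sw) (g \o sw) = smul f g \o sw.
Proof. by apply/funext => e; rewrite /= /smul splits_sw. Qed.

Lemma sapply_sw U W (F : U -> expo -> W) (w : expo -> U) :
  sapply (fun x => F x \o sw) (w \o sw) = sapply F w \o sw.
Proof. by apply/funext => e; rewrite /= /sapply splits_sw. Qed.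

Lemma mono_sw i j k l : mono i j k l \o sw = mono j i l k :> (expo -> K).
Proof.
apply/funext => -[[a b] [c d]] /=; rewrite /mono; congr (nat_of_bool _)%:R.
by apply/eqP/eqP => -[-> -> -> ->].
Qed.

Lemma spow_sw f n : spow (f \o sw) n = spow f n \o sw.
Proof. by elim: n => [|n IHn]; rewrite ?mono_sw //= IHn smul_sw. Qed.

Lemma theta21_sw : theta21 = theta12 \o sw :> (expo -> K).
Proof.
apply/funext => e; rewrite /= /theta21 /theta12; congr (_ - _).
  by rewrite -[RHS]/((mono 0 0 1 0 \o sw) e) mono_sw.
apply: eq_fsbigr => n _; congr (_ * _).
by rewrite -[RHS]/((mono _ _ _ _ \o sw) e) mono_sw.
Qed.

Lemma z12_sw : z12 \o sw = (fun e => - z12 e) :> (expo -> K).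
Proof.
apply/funext => e; rewrite /= /z12 opprB /z1 /z2.
by rewrite -![mono _ _ _ _ (sw e)]/((mono _ _ _ _ \o sw) e) !mono_sw.
Qed.

Lemma spow_z12_sw n : spow z12 n \o sw = (fun e => (-1) ^+ n * spow z12 n e) :> (expo -> K).
Proof.
rewrite -spow_sw z12_sw; elim: n => [|n IHn].
  by apply/funext => e; rewrite mul1r.
rewrite /= -/(spow _ _) IHn smulZr; apply/funext => e; rewrite exprS -mulrA.
have -> : (fun e => - z12 e) = (fun e => -1 * z12 e) :> (expo -> K).
  by apply/funext => e'; rewrite mulN1r.
by rewrite smulZl mulrCA.
Qed.

Lemma sexp_sw U theta (A : U -> U) x : sexp (theta \o sw) A x = sexp theta A x \o sw.
Proof. by apply/funext => e /=; apply: eq_fsbigr => k _; rewrite spow_sw. Qed.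

End Swap.

Section Derivation.
Context {K : numFieldType}.
Implicit Types (U W : lmodType K) (f g : expo -> K).

(** The common form of ∂_z and z^-1 ∂_ζ on coefficients: weight by an exponent, then shift.
    Additivity of the weight [c] is what makes such an operator a derivation. *)
Definition dshift U (d : expo) (c : expo -> K) (f : expo -> U) : expo -> U :=
  fun e => c (e + d) *: f (e + d).

Lemma expo_addI (d : expo) : injective (fun e => e + d).
Proof.
move=> [[i j] [k l]] [[i' j'] [k' l']]; rewrite !expoDE /= => -[h1 h2 h3 h4].
by congr (_, _, (_, _)); lia.
Qed.

(** Exponents of ζ are natural numbers, so the shift by [d] is injective but may fail to be
    surjective; the hypothesis makes the terms outside its image vanish. *)
Lemma splits_shift (U : nmodType) d e (phi : expo * expo -> U) :
  (forall a b, phi (a, b) != 0 -> exists a', a = a' + d) ->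
  \sum_(p \in splits (e + d)) phi p = \sum_(p \in splits e) phi (p.1 + d, p.2).
Proof.
move=> hphi.
pose A : set (expo * expo) := fun p => splits (e + d) p /\ exists a, p.1 = a + d.
rewrite -(fsbig_widen A); last 2 first.
- by move=> p [].
- move=> [a b] [/= hp hA]; apply/eqP/negPn/negP => /hphi ha.
  by apply: hA; split.
apply: (reindex_fsbig (fun p : expo * expo => (p.1 + d, p.2))).
split=> [[a b] /= hab|p q _ _ h|].
- by split; [rewrite /splits /= addrAC -hab | exists a].
- have h1 : p.1 = q.1 := expo_addI (congr1 fst h).
  have h2 : p.2 = q.2 := congr1 snd h.
  by rewrite [p]surjective_pairing h1 h2 -surjective_pairing.
move=> [a b] /= [hab [a' /= ha]]; exists (a', b); last by rewrite /= ha.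
by apply: (@expo_addI d); rewrite /= -hab /= ha addrAC.
Qed.

Lemma lsupp_dshift U d c (f : expo -> U) : lsupp f -> lsupp (dshift d c f).
Proof.
move=> [m hm]; exists (m - d.1.2) => v; have [n hn] := hm (v + d.1.2).
exists (n - d.1.1) => e; rewrite scaler_eq0 negb_or => /andP[_ /hn].
by rewrite expoDE /=; lia.
Qed.

(** The Leibniz rule, from c (a + b) = c a + c b. The condition on [c] says that an exponent that is
    not a shift by [d] has weight 0, as with ∂_ζ on ζ^0. *)
Lemma dshift_sscale U d (c : expo -> K) f (w : expo -> U) :
  (forall a b, c (a + b) = c a + c b) ->
  (forall a, c a != 0 -> exists a', a = a' + d) -> lsupp f -> lsupp w ->
  dshift d c (sscale f w)
  = fun e => sscale (dshift (U := K^o) d c f) w e + sscale f (dshift d c w) e.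
Proof.
move=> cD cd hf hw; apply/funext => e; rewrite /dshift /sscale -fsum_scale.
have hcf : lsupp (fun a => c a * f a).
  by apply: lpred_sub hf => a; apply: contra_neq => ->; rewrite mulr0.
have hcw : lsupp (fun a => c a *: w a).
  by apply: lpred_sub hw => a; apply: contra_neq => ->; rewrite scaler0.
transitivity (\sum_(p \in splits (e + d)) ((c p.1 * f p.1) *: w p.2
                                         + f p.1 *: (c p.2 *: w p.2))).
  apply: eq_fsbigr => p; rewrite inE => hp; rewrite -hp cD scalerDl !scalerA.
  by rewrite [f p.1 * _]mulrC.
rewrite splits_sumD; last 2 first.
- exact: (summable_sscale (e + d) hcf hw).
- exact: (summable_sscale (e + d) hf hcw).
congr (_ + _).
  apply: (splits_shift e (phi := fun p => (c p.1 * f p.1) *: w p.2)) => a b /=.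
  by rewrite scaler_eq0 mulf_eq0 !negb_or => /andP[/andP[/cd]].
rewrite [LHS]splits_swap [RHS]splits_swap /=.
apply: (splits_shift e (phi := fun p => f p.2 *: (c p.1 *: w p.1))) => a b /=.
by rewrite !scaler_eq0 !negb_or => /and3P[_ /cd].
Qed.

(* The operator [∂_z1 + z1^-1 ∂_ζ1 + ∂_z2 + z2^-1 ∂_ζ2]. *)
Definition Delta U (w : expo -> U) : expo -> U := fun e =>
  (dshift (1%:Z, 0%:Z, (0%N, 0%N)) (fun e => e.1.1%:~R) w e
   + dshift (1%:Z, 0%:Z, (1%N, 0%N)) (fun e => e.2.1%:R) w e)
  + (dshift (0%:Z, 1%:Z, (0%N, 0%N)) (fun e => e.1.2%:~R) w e
   + dshift (0%:Z, 1%:Z, (0%N, 1%N)) (fun e => e.2.2%:R) w e).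

Lemma DeltaE U (w : expo -> U) i j k l : Delta w (i, j, (k, l)) =
  ((i + 1)%:~R *: w (i + 1, j, (k, l)) + k.+1%:R *: w (i + 1, j, (k.+1, l)))
  + ((j + 1)%:~R *: w (i, j + 1, (k, l)) + l.+1%:R *: w (i, j + 1, (k, l.+1))).
Proof. by rewrite /Delta /dshift !expoDE /= !addr0 !addn0 !addn1. Qed.

Lemma Delta_sscale U f (w : expo -> U) : lsupp f -> lsupp w ->
  Delta (sscale f w)
  = fun e => sscale (Delta (U := K^o) f) w e + sscale f (Delta w) e.
Proof.
move=> hf hw; apply/funext => e; rewrite {1}/Delta !dshift_sscale //; last 8 first.
- by move=> a b; rewrite expoDE natrD.
- move=> [[i j] [k [|l]]]; rewrite ?eqxx // => _; exists (i, j - 1, (k, l)).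
  by rewrite expoDE /= subrK addr0 !addn0 addn1.
- by move=> a b; rewrite expoDE intrD.
- move=> [[i j] [k l]] _; exists (i, j - 1, (k, l)).
  by rewrite expoDE /= subrK addr0 !addn0.
- by move=> a b; rewrite expoDE natrD.
- move=> [[i j] [[|k] l]]; rewrite ?eqxx // => _; exists (i - 1, j, (k, l)).
  by rewrite expoDE /= subrK addr0 !addn0 addn1.
- by move=> a b; rewrite expoDE intrD.
- move=> [[i j] [k l]] _; exists (i - 1, j, (k, l)).
  by rewrite expoDE /= subrK addr0 !addn0.
rewrite /Delta !sscaleDl ?sscaleDr //;
  try by repeat first [apply: lsuppD | apply: lsupp_dshift].
by rewrite [RHS]addrACA; congr (_ + _); rewrite [RHS]addrACA.
Qed.

End Derivation.

(** * Expansions of powers of z12 and of its logarithm *)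

(** On the antidiagonal, p + 1 = s + (p + 1 - s). With divided powers for [d] this is the derivative
    of a product of two exponentials, in the form used by inductions that end by cancelling p +
    1. *)
Lemma binomial_rec (K : fieldType) (U : lmodType K) (d : nat -> nat -> U) p :
  p.+1%:R *: (\sum_(s < p.+2) d s (p.+1 - s)%N)
  = \sum_(s < p.+1) s.+1%:R *: d s.+1 (p - s)%N
    + \sum_(s < p.+1) (p - s).+1%:R *: d s (p - s).+1.
Proof.
rewrite scaler_sumr.
transitivity (\sum_(s < p.+2) s%:R *: d s (p.+1 - s)%N
            + \sum_(s < p.+2) (p.+1 - s)%:R *: d s (p.+1 - s)%N).
  rewrite -big_split; apply: eq_bigr => s _ /=.
  by rewrite -scalerDl -natrD subnKC // -ltnS.
congr (_ + _).
  by rewrite big_ord_recl scale0r add0r; apply: eq_bigr => s _; rewrite subSS.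
rewrite big_ord_recr subnn scale0r /= addr0; apply: eq_bigr => s _.
by rewrite subSn // -ltnS.
Qed.

Section Taylor.
Context {K : numFieldType}.
Implicit Types (U W : lmodType K) (f g : expo -> K).

(* f is the expansion in z2 of a function of z12 and ζ12 that reduces to
   z1^n ζ1^k at z2 = 0. *)
Definition taylor (n : int) (k : nat) f := [/\
  forall e, f e != 0 -> [/\ 0 <= e.1.2, e.1.1 + e.1.2 = n & e.2.2 = 0%N],
  forall i p, f (i, 0, (p, 0%N)) = mono n 0 k 0 (i, 0, (p, 0%N))
  & forall e, Delta (U := K^o) f e = 0].

Lemma taylor_lsupp n k f : taylor n k f -> lsupp f.
Proof. by case=> h _ _; exists 0 => v; exists (n - v) => e /h[]; lia. Qed.

Lemma monoE i j k l (a b : int) (c d : nat) : mono i j k l (a, b, (c, d))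
  = ((a == i) && (b == j) && (c == k) && (d == l))%:R :> K.
Proof.
rewrite /mono; congr (nat_of_bool _)%:R; apply/eqP/idP.
  by case=> -> -> -> ->; rewrite !eqxx.
by move=> /andP[/andP[/andP[/eqP -> /eqP ->] /eqP ->] /eqP ->].
Qed.

(** Neither factor has negative powers of z2, so at z2 = 0 only the leading term z1^n ζ1^k of [f]
    contributes. *)
Lemma sscale_taylor0 U n k f (w : expo -> U) i p l : taylor n k f ->
  (forall e, w e != 0 -> 0 <= e.1.2) ->
  sscale f w (i, 0, (p, l)) = if (k <= p)%N then w (i - n, 0, ((p - k)%N, l)) else 0.
Proof.
move=> [hf f0 _] hw; rewrite /sscale.
rewrite (@splits_sum _ [:: (n, 0, (k, 0%N))] [:: (i - n, 0, ((p - k)%N, l))]) //.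
  rewrite !big_seq1 big_mkcond big_seq1 /= f0 monoE !eqxx scale1r.
  rewrite expoDE /=; have [h|h] := leqP k p; last first.
    by rewrite ifF //; apply/eqP; case; lia.
  by rewrite ifT //; apply/eqP; congr (_, _, (_, _)); lia.
move=> a b hab /=; rewrite scaler_eq0 negb_or => /andP[ha hb].
have [j1 _ l1] := hf _ ha; have j2 := hw _ hb.
case: a b hab ha hb j1 j2 l1 => [[a1 a2] [a3 a4]] [[b1 b2] [b3 b4]].
rewrite expoDE /= => -[h1 h2 h3 h4] ha _ j1 j2 l1.
have e2 : a2 = 0 by lia.
move: ha; rewrite e2 l1 f0 monoE pnatr_eq0 eqb0 negbK.
move=> /andP[/andP[/andP[/eqP ha1 _] /eqP ha3] _]; rewrite !inE; split; apply/eqP; last first.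
  by congr (_, _, (_, _)); lia.
by congr (_, _, (_, _)); lia.
Qed.

Lemma sscale_taylor_supp U n k f (w : expo -> U) e : taylor n k f ->
  (forall e, w e != 0 -> 0 <= e.1.2 /\ e.2.2 = 0%N) -> sscale f w e != 0 ->
  0 <= e.1.2 /\ e.2.2 = 0%N.
Proof.
move=> [hf _ _] hw.
move=> /(@fsbigN1 _ _ _ _ _ _ (fun _ p => f p.1 *: w p.2) tt)[[a b] /= <-].
rewrite scaler_eq0 negb_or => /andP[/hf[h1 _ h2] /hw[h3 h4]].
by rewrite expoDE /=; lia.
Qed.

(** Series killed by the derivation [Delta] are closed under products, so only z12, its expanded
    inverse and ϑ12 have to be checked by hand. *)
Lemma taylor_mul n k f n' k' g : taylor n k f -> taylor n' k' g ->
  taylor (n + n') (k + k') (smul f g).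
Proof.
move=> hf hg; have [sf _ Df] := hf; have [sg g0 Dg] := hg.
split=> [e|i p|e].
- move=> /(@fsbigN1 _ _ _ _ _ _ (fun _ p => f p.1 * g p.2) tt)[[a b] /= <-].
  rewrite mulf_eq0 negb_or => /andP[/sf[h1 h2 h3] /sg[h4 h5 h6]].
  by rewrite expoDE /=; split; lia.
- rewrite -[smul f g]/(sscale (U := K^o) f g).
  rewrite (@sscale_taylor0 K^o _ _ _ _ _ _ _ hf); last by move=> e /sg[].
  rewrite g0 !monoE; case: leqP => h.
    by congr (nat_of_bool _)%:R; lia.
  by rewrite (_ : _ && _ = false) //; lia.
- rewrite -[smul f g]/(sscale (U := K^o) f g) Delta_sscale; last 2 first.
  + exact: taylor_lsupp hf.
  + exact: taylor_lsupp hg.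
  have -> : Delta (U := K^o) f = fun=> 0 by apply/funext.
  have -> : Delta (U := K^o) g = fun=> 0 by apply/funext.
  rewrite /sscale !fsbig1 ?addr0 // => p _; first by rewrite scaler0.
  by rewrite scale0r.
Qed.

Lemma taylor_one : taylor 0 0 (mono 0 0 0 0).
Proof.
split=> [[[i j] [k l]]|//|[[i j] [k l]]].
  by rewrite monoE pnatr_eq0 eqb0 negbK /=; split; lia.
rewrite DeltaE !monoE /= !andbF !scaler0 !addr0 ?andbF /=.
case: (eqVneq (i + 1) 0) => [->|_]; last rewrite scaler0 add0r.
  rewrite scale0r add0r; case: (eqVneq (j + 1) 0) => [->|_]; first by rewrite scale0r.
  by rewrite andbF scaler0.
case: (eqVneq (j + 1) 0) => [->|_]; first by rewrite scale0r.
by rewrite andbF scaler0.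
Qed.

Lemma taylor_z12 : taylor 1 0 z12.
Proof.
split=> [[[i j] [k l]]|i p|[[i j] [k l]]].
- rewrite /z12 /z1 /z2 !monoE; set A := _ && _; set B := _ && _.
  have [hA _|hA] := boolP A; first by rewrite /A in hA; split=> /=; lia.
  have [hB _|hB] := boolP B; first by rewrite /B in hB; split=> /=; lia.
  by rewrite subrr eqxx.
- by rewrite /z12 /z1 /z2 !monoE /= andbF subr0.
rewrite DeltaE /z12 /z1 /z2 !monoE.
have [-> | hk] := eqVneq k 0%N; last by rewrite !andbF !subrr !scaler0 !addr0.
have [-> | hl] := eqVneq l 0%N; last by rewrite !andbF !subrr !scaler0 !addr0.
rewrite /= !andbF !andbT subrr !scaler0 !addr0.
have -> : (j + 1 == 1) = (j == 0) by lia.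
have -> : (i + 1 == 1) = (i == 0) by lia.
have [->|hi] := eqVneq i 0.
  have [->|hj] := eqVneq j 0; first by rewrite !subr0 sub0r !scale1r subrr.
  by rewrite andbF !subrr !scaler0 addr0.
rewrite /= !sub0r; have [hi1|hi1] := eqVneq (i + 1) 0.
  rewrite hi1 scale0r add0r; have -> : (i == 1) = false by lia.
  by rewrite subrr scaler0.
rewrite /= mulr0n oppr0 scaler0 add0r addr0; have [hj|hj] := eqVneq (j + 1) 0.
  by rewrite hj scale0r.
by rewrite andbF scaler0.
Qed.

Lemma theta12E (i j : int) (k l : nat) : theta12 (i, j, (k, l)) =
  mono 0 0 1 0 (i, j, (k, l))
  - (if [&& 0 < j, i == - j, k == 0%N & l == 0%N] then (j%:~R)^-1 else 0) :> K.
Proof.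
rewrite /theta12; congr (_ - _).
have [h|h] := boolP [&& 0 < j, i == - j, k == 0%N & l == 0%N].
  have /and4P[j0 /eqP -> /eqP -> /eqP ->] := h.
  have [m jm] : exists m : nat, j = m%:Z by exists (absz j); lia.
  rewrite {}jm in h j0 *; rewrite -(fsbig_widen [set m]%classic) ?fsbig_set1.
  - by rewrite monoE !eqxx mulr1.
  - by move=> n /= ->; lia.
  - move=> n [/= n0 hn]; rewrite monoE (_ : _ && _ = false) ?mulr0 //.
    by apply/negP => hh; apply: hn; lia.
apply: fsbig1 => n /= n0; rewrite monoE (_ : _ && _ = false) ?mulr0 //.
by apply: contraNF h; lia.
Qed.

Lemma iota_inv_z12E (i j : int) (k l : nat) : iota_inv_z12 (i, j, (k, l)) =
  [&& 0 <= j, i == - j - 1, k == 0%N & l == 0%N]%:R :> K.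
Proof.
rewrite /iota_inv_z12.
have [h|h] := boolP [&& 0 <= j, i == - j - 1, k == 0%N & l == 0%N].
  have /and4P[j0 /eqP -> /eqP -> /eqP ->] := h.
  have [m jm] : exists m : nat, j = m%:Z by exists (absz j); lia.
  rewrite {}jm in h j0 *; rewrite -(fsbig_widen [set m]%classic) ?fsbig_set1 //.
  - by rewrite monoE !eqxx.
  - move=> n [/= n0 hn]; rewrite monoE (_ : _ && _ = false) //.
    by apply/negP => hh; apply: hn; lia.
apply: fsbig1 => n /= n0; rewrite monoE (_ : _ && _ = false) //.
by apply: contraNF h; lia.
Qed.

(** The point is the vanishing of [Delta]: on the logarithm series ∂1 + ∂2 telescopes to -z1^-1,
    which cancels the z1^-1 coming from ζ1. *)
Lemma taylor_theta12 : taylor 0 1 theta12.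
Proof.
split=> [[[i j] [k l]]|i p|[[i j] [k l]]].
- rewrite theta12E monoE; case: ifP => [h _|_]; first by rewrite /=; split; lia.
  by rewrite subr0 pnatr_eq0 eqb0 negbK /=; split; lia.
- by rewrite theta12E ltxx subr0.
rewrite DeltaE !theta12E !monoE.
have [-> | hl] := eqVneq l 0%N; last by rewrite !andbF !subrr !scaler0 !addr0.
rewrite !andbF !andbT !subr0 scaler0 addr0.
case: k => [|k]; last first.
  rewrite !andbF !subr0 scaler0 addr0.
  have [->|_] := eqVneq (i + 1) 0; rewrite ?scale0r ?scaler0 add0r.
    have [->|_] := eqVneq (j + 1) 0; first by rewrite scale0r.
    by rewrite andbF scaler0.
  have [->|_] := eqVneq (j + 1) 0; first by rewrite scale0r.
  by rewrite andbF scaler0.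
rewrite !andbF !sub0r !andbT scale1r.
have [hij|hij] := eqVneq i (- j - 1); last first.
  have -> : (i + 1 == - j) = false by lia.
  have -> : (i == - (j + 1)) = false by lia.
  have -> : (i + 1 == 0) && (j == 0) = false by lia.
  by rewrite !andbF oppr0 !scaler0 !addr0.
have -> : (i + 1 == - j) by lia.
have -> : (i == - (j + 1)) by lia.
have -> : (i + 1 == 0) && (j == 0) = (j == 0) by lia.
rewrite !andbT; have -> : (0 < j + 1) = (0 < j) || (j == 0) by lia.
have -> : i + 1 = - j by lia.
(* At j = 0 the z1^-1 produced by ζ1 meets the unmatched end of the telescoping sum; for j > 0 two
   terms of the logarithm series cancel. *)
have [->|j0] := eqVneq j 0; first by rewrite ltxx !oppr0 scaler0
  !scalerN /= scale1r invr1 add0r subrr.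
rewrite orbF addr0; case: ifP => j1; last by rewrite oppr0 !scaler0 addr0.
rewrite intrN scaleNr !scalerN opprK.
have j2 : (j%:~R : K) != 0 by rewrite intr_eq0.
have j3 : ((j + 1)%:~R : K) != 0 by rewrite intr_eq0; lia.
rewrite -[LHS]/(j%:~R * j%:~R^-1 - (j + 1)%:~R * (j + 1)%:~R^-1).
by rewrite !mulfV // subrr.
Qed.

Lemma taylor_inv : taylor (-1) 0 iota_inv_z12.
Proof.
split=> [[[i j] [k l]]|i p|[[i j] [k l]]].
- rewrite iota_inv_z12E pnatr_eq0 eqb0 negbK /=.
  by case/and4P => ? /eqP ? _ /eqP ?; split; lia.
- rewrite iota_inv_z12E monoE; congr (nat_of_bool _)%:R; lia.
rewrite DeltaE !iota_inv_z12E !andbF !scaler0 !addr0.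
have [hij|hij] := eqVneq i (- j - 2); last first.
  have -> : (i + 1 == - j - 1) = false by lia.
  have -> : (i == - (j + 1) - 1) = false by lia.
  by rewrite !andbF !scaler0 addr0.
have -> : (i + 1 == - j - 1) by lia.
have -> : (i == - (j + 1) - 1) by lia.
have [->|hj] := eqVneq j (-1); first by rewrite /= scaler0 scale0r addr0.
have -> : (0 <= j + 1) = (0 <= j) by lia.
have -> : i + 1 = - (j + 1) by lia.
by rewrite intrN scaleNr addNr.
Qed.

Lemma taylor_pow n k f p : taylor n k f -> taylor (n * p%:Z) (k * p) (spow f p).
Proof.
move=> hf; elim: p => [|p IHp]; first by rewrite mulr0 muln0; exact: taylor_one.
by rewrite -addn1 PoszD mulrDr mulr1 mulnDr muln1 addrC addnC addn1; exact: taylor_mul.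
Qed.

Lemma taylor_iota n k : taylor n k (smul (iota_z12 n) (spow theta12 k)).
Proof.
rewrite -[n in taylor n]addr0 -[k in taylor _ k]add0n; apply: taylor_mul; last first.
  by have := taylor_pow k taylor_theta12; rewrite mul0r mul1n.
case: n => m /=; first by have := taylor_pow m taylor_z12; rewrite mul1r mul0n.
by have := taylor_pow m.+1 taylor_inv; rewrite mulN1r mul0n NegzE.
Qed.

Lemma taylor_z12_theta12 N k : taylor N%:Z k (smul (spow z12 N) (spow theta12 k)).
Proof. exact: taylor_iota N%:Z k. Qed.

End Taylor.

(** * Iterated products of fields *)

Section Families.
Context {K : numFieldType}.
Implicit Types (U W X : lmodType K).

Definition fam_bound U W (f : int -> nat -> U -> W) (x : U) :=
  exists (m : int) (L : nat), forall n k, f n k x != 0 -> m <= n /\ (k < L)%N.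

Lemma fam_bound0 U W (f : int -> nat -> U -> W) :
  (forall n k, linear (f n k)) -> fam_bound f 0.
Proof. by move=> fl; exists 0, 0%N => n k; rewrite (lin0 (fl n k)) eqxx. Qed.

Lemma fam_boundD U W (f : int -> nat -> U -> W) x y :
  (forall n k, linear (f n k)) -> fam_bound f x -> fam_bound f y ->
  fam_bound f (x + y).
Proof.
move=> fl [m [L h]] [m' [L' h']]; exists (Num.min m m'), (maxn L L') => n k.
rewrite (linD (fl n k)); have [->|/h hx _] := eqVneq (f n k x) 0; last by lia.
by rewrite add0r => /h'; lia.
Qed.

(** A bound may be lowered, so the finitely many pairs (j, l) share the minimum of their bounds. *)
Lemma int_nat_bound (P : int -> nat -> int -> Prop) :
  (forall j l n n', n' <= n -> P j l n -> P j l n') ->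
  (forall j l, exists n, P j l n) ->
  forall (m v : int) (L : nat), exists n, forall j l,
    m <= j -> j <= v -> (l < L)%N -> P j l n.
Proof.
move=> Pm Pe m v L.
have PL (M : nat) j : exists n, forall l, (l < M)%N -> P j l n.
  elim: M => [|M [n IHn]]; first by exists 0.
  have [n' hn'] := Pe j M; exists (Num.min n n') => l.
  rewrite ltnS leq_eqVlt => /orP[/eqP ->|/IHn]; first by apply: Pm hn'; lia.
  by apply: Pm; lia.
have PM (M : nat) : exists n, forall j l, m <= j -> j < m + M%:Z -> (l < L)%N -> P j l n.
  elim: M => [|M [n IHn]]; first by exists 0 => j l; lia.
  have [n' hn'] := PL L (m + M%:Z); exists (Num.min n n') => j l hj hjM hl.
  have [->|hne] := eqVneq j (m + M%:Z); first by apply: Pm (hn' _ hl); lia.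
  by apply: (Pm _ _ n); [lia | apply: IHn => //; lia].
have [n hn] := PM (absz (v - m + 1)); exists n => j l h1 h2 h3.
by apply: hn => //; lia.
Qed.

Definition tail2 U W (G : U -> expo -> W) := forall y, exists (m : int) (L : nat),
  forall e, G y e != 0 -> [/\ e.1.1 = 0, m <= e.1.2, e.2.1 = 0%N & (e.2.2 < L)%N].

(** The shape of an outer field, as [tail2] is that of an inner field in z2 and ζ2 alone. Bounding
    the total degree instead of the degree in z1 covers Y(z1) and Y(-z1) as well as the expansion of
    Y(z12). *)
Definition head1 U W (F : U -> expo -> W) := forall x, exists n : int,
  forall e, F x e != 0 -> 0 <= e.1.2 /\ n <= e.1.1 + e.1.2.

Lemma tail2_lsupp U W (G : U -> expo -> W) y : tail2 G -> lsupp (G y).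
Proof.
by move=> /(_ y)[m [L h]]; exists m => v; exists 0 => e /h[-> ? _ _].
Qed.

(** Once the exponent of z2 is bounded above, only finitely many coefficients of [G y] enter, each
    with its own bound under [F], and these bounds can be made uniform. *)
Lemma head_tail U W X (F : W -> expo -> X) (G : U -> expo -> W) y :
  (forall e, F 0 e = 0) -> head1 F -> tail2 G ->
  jpred (fun a b => F (G y b) a != 0).
Proof.
move=> F0 hF /(_ y)[m [L hG]]; exists (Num.min 0 m) => v.
pose P j l n := forall e, F (G y (0, j, (0%N, l))) e != 0 ->
   0 <= e.1.2 /\ n <= e.1.1 + e.1.2.
have [n hn] : exists n, forall j l, m <= j -> j <= v -> (l < L)%N -> P j l n.
  apply: int_nat_bound => [j l n n' hnn h e /h|j l]; first by lia.
  exact: hF.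
(* From n <= a.1.1 + a.1.2 and a.1.2 <= v - m. *)
exists (Num.min 0 (n - v + m)) => a [[i j] [k l]] h.
have /hG[/= i0 j0 k0 l0] : G y (i, j, (k, l)) != 0.
  by apply: contra_neq h => ->; rewrite F0.
subst i k; have [n' hn'] := hF (G y (0, j, (0%N, l))).
have [a0 _] := hn' a h.
split; [lia | lia | move=> hv].
by have := hn j l j0 _ l0 a h; lia.
Qed.

Lemma sexpE U theta (A : U -> U) x n e : linear A -> iter n A x = 0 ->
  sexp theta A x e = \sum_(k < n) ((k`!)%:R^-1 * spow theta k e) *: iter k A x.
Proof.
move=> Al h; rewrite /sexp (@fsum_nat U n (fun k =>
  ((k`!)%:R^-1 * spow theta k e) *: iter k A x)) // => k hk.
by rewrite (nilp_max Al hk h) scaler0.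
Qed.

Section Expand.
Context {U W X : lmodType K} (F : W -> expo -> X) (G : U -> expo -> W).
Hypotheses (Fl : forall e, linear (F ^~ e)) (Gl : forall e, linear (G ^~ e)).
Hypotheses (Fh : head1 F) (Gt : tail2 G).
Variables (f theta : expo -> K).
Hypotheses (hf : lsupp f) (ht : forall k, lsupp (spow theta k)).

Let hk k : lsupp (fun e => (k`!)%:R^-1 * smul f (spow theta k) e).
Proof.
apply: lpred_sub (lsupp_smul hf (ht k)) => e.
by apply: contra_neq => ->; rewrite mulr0.
Qed.

Lemma sscale_sexp (A : U -> U) x n : linear A -> iter n A x = 0 ->
  sscale f (sexp theta A x) = fun e =>
    \sum_(k < n) ((k`!)%:R^-1 * smul f (spow theta k) e) *: iter k A x.
Proof.
move=> Al Ax; apply/funext => e.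
transitivity (\sum_(p \in splits e) \sum_(k < n)
   ((k`!)%:R^-1 * (f p.1 * spow theta k p.2)) *: iter k A x).
  apply: eq_fsbigr => p _; rewrite (sexpE _ _ Al Ax) scaler_sumr.
  by apply: eq_bigr => k _; rewrite scalerA mulrCA.
rewrite (@splits_bigsum _ n e (fun k p =>
   ((k`!)%:R^-1 * (f p.1 * spow theta k p.2)) *: iter k A x)); last first.
  move=> k; apply: jpred_summable (jpred_prod hf (ht k)) _ => a b _ /=.
  by rewrite scaler_eq0 !mulf_eq0 !negb_or -!andbA => /and4P[_ -> ->].
apply: eq_bigr => k _; under eq_fsbigr do rewrite -scalerA.
rewrite fsum_scale -scalerA; congr (_ *: _).
have sD : {morph (fun c : K^o => c *: iter k A x) : c d / c + d}.
  by move=> c d; rewrite scalerDl.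
have s0 : (fun c : K^o => c *: iter k A x) 0 = 0 by rewrite scale0r.
apply/esym/(@splits_additive K^o U _ e (fun p => f p.1 * spow theta k p.2) s0 sD).
exact: (@summable_sscale K K^o _ _ _ hf (ht k)).
Qed.

(** The normal form shared by locality and both sides of associativity: nilpotence truncates the
    exponential, and scalar series then move out of both fields. The rest of the argument takes
    place between [F] and [G], one power of [A] at a time. *)
Lemma sapply2_sexp (A : U -> U) x n : linear A -> iter n A x = 0 ->
  sapply F (sapply G (sscale f (sexp theta A x))) = fun e =>
    \sum_(k < n) (k`!)%:R^-1 *:
      sscale (smul f (spow theta k)) (sapply F (G (iter k A x))) e.
Proof.
move=> Al Ax; have F0 e : F 0 e = 0 := lin0 (Fl e).
have hJ y := head_tail y F0 Fh Gt; have hG y := tail2_lsupp y Gt.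
pose h k : expo -> K := fun e => (k`!)%:R^-1 * smul f (spow theta k) e.
transitivity (sapply F (fun e => \sum_(k < n) sscale (h k) (G (iter k A x)) e)).
  congr sapply; rewrite (sscale_sexp Al Ax); apply/funext => e; rewrite /sapply.
  under eq_fsbigr do rewrite (lin_sum (Gl _)).
  rewrite (@splits_bigsum _ n e (fun k p => G (h k p.2 *: iter k A x) p.1)).
    apply: eq_bigr => k _; rewrite /sscale [RHS]splits_swap /=.
    by apply: eq_fsbigr => p _; rewrite (linZ (Gl _)).
  move=> k; apply: jpred_summable (jpred_prod (hG (iter k A x)) (hk k)) _ => a b _ /=.
  by rewrite (linZ (Gl _)) scaler_eq0 negb_or => /andP[-> ->].
rewrite (@sapply_sum _ _ _ F Fl n (fun k => sscale (h k) (G (iter k A x)))); last first.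
  by move=> k; exact: (jpred_sscale Fl (hk k) (hG _) (hJ _)).
apply/funext => e; apply: eq_bigr => k _.
by rewrite (sapply_sscale Fl (hk k) (hG _) (hJ _)) /h sscaleZl.
Qed.

End Expand.

End Families.

Section Monomials.
Context {K : numFieldType}.

Lemma smul_mono i j k l i' j' k' l' :
  smul (mono i j k l) (mono i' j' k' l')
  = mono (i + i') (j + j') (k + k') (l + l') :> (expo -> K).
Proof.
apply/funext => e; rewrite /smul.
rewrite (@splits_sum _ [:: (i, j, (k, l))] [:: (i', j', (k', l'))]) //.
  rewrite big_seq1 big_mkcond big_seq1 /= !monoE !eqxx mulr1 expoDE /= /mono eq_sym.
  by case: eqP.
move=> a b _ /=; rewrite mulf_eq0 negb_or /mono !pnatr_eq0 !eqb0 !negbK !inE.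
by case/andP.
Qed.

Lemma spow_zeta1 p : spow zeta1 p = mono 0 0 p 0 :> (expo -> K).
Proof. by elim: p => //= p ->; rewrite smul_mono !addr0 add1n. Qed.

Lemma spow_zeta2 p : spow zeta2 p = mono 0 0 0 p :> (expo -> K).
Proof. by elim: p => //= p ->; rewrite smul_mono !addr0 add1n. Qed.

Lemma tmapZr {U V V' : lmodType K} c (g : V -> V') (y : tensor U V) : linear g ->
  tmap id (fun x => c *: g x) y = c *: tmap id g y.
Proof.
move=> gl; move: y; have cgl := scale_lin c gl; apply: tens_ext.
- exact: tmap_lin.
- by apply: scale_lin; exact: tmap_lin.
- by move=> x w; rewrite !tmap_tens // (linZ (tens_linr x)).
Qed.

Lemma tmap0r {U V V' : lmodType K} (y : tensor U V) :
  tmap id (fun _ : V => 0 : V') y = 0.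
Proof.
have zl : linear (fun _ : V => 0 : V') by move=> c x z; rewrite scaler0 addr0.
transitivity (0 *: tmap id (fun _ : V => 0 : V') y); last by rewrite scale0r.
rewrite -(tmapZr 0 y zl); congr (tmap id _ y).
by apply/funext => x; rewrite scaler0.
Qed.

Lemma tmap0l {U U' V : lmodType K} (y : tensor U V) :
  tmap (fun _ : U => 0 : U') id y = 0.
Proof.
have zl : linear (fun _ : U => 0 : U') by move=> c x z; rewrite scaler0 addr0.
move: y; apply: tens_ext; first exact: tmap_lin.
  by move=> c x z; rewrite scaler0 addr0.
by move=> x w; rewrite tmap_tens // (lin0 (@tens_linl _ _ _ w)).
Qed.

(** [F] involves only z1, ζ1 and [w] only z2, ζ2, so the convolution has a single term. *)
Lemma sapply_sep {U W : lmodType K} (F : U -> expo -> W) (w : expo -> U) i j k l :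
  (forall e, F 0 e = 0) ->
  (forall x e, F x e != 0 -> e.1.2 = 0 /\ e.2.2 = 0%N) ->
  (forall e, w e != 0 -> e.1.1 = 0 /\ e.2.1 = 0%N) ->
  sapply F w (i, j, (k, l)) = F (w (0, j, (0%N, l))) (i, 0, (k, 0%N)).
Proof.
move=> F0 hF hw; rewrite /sapply.
rewrite (@splits_sum _ [:: (i, 0, (k, 0%N))] [:: (0, j, (0%N, l))]) //.
  by rewrite big_seq1 big_mkcond big_seq1 /= expoDE /= addr0 add0r addn0 add0n eqxx.
move=> [[a1 a2] [a3 a4]] [[b1 b2] [b3 b4]]; rewrite expoDE /= => -[h1 h2 h3 h4] h.
have [/= e1 e2] := hF _ _ h.
have [/= e3 e4] : b1 = 0 /\ b3 = 0%N.
  by apply: (hw (b1, b2, (b3, b4))); apply: contra_neq h => ->; rewrite F0.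
by rewrite !inE; split; apply/eqP; congr (_, _, (_, _)); lia.
Qed.

End Monomials.

(** * Fields of a logarithmic vertex algebra and locality on tensors *)

Section Fields.
Context {K : numFieldType} {V : logVA K}.
Local Notation Y := (@Yop K V).
Local Notation S := (braid V).
Local Notation P := (@super_flip K V).

Lemma Ycoef_lin n k : linear (Ycoef Y n k).
Proof. exact: tlift_linear (@Yop_bilinear K V n k). Qed.

Lemma YcoefE n k a b : Ycoef Y n k (a ⊗ b) = Yop a b n k.
Proof. exact: tlift_tens (@Yop_bilinear K V n k) a b. Qed.

Lemma braid_lin : linear S.
Proof. by move=> c x y; rewrite linearP. Qed.

Let S12l := on12_lin braid_lin.

Lemma Ycoef_bound x : fam_bound (Ycoef Y) x.
Proof.
move: x; apply: tens_ind => [|s t|a b].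
- exact: fam_bound0 Ycoef_lin.
- exact: fam_boundD Ycoef_lin.
have [m [L h]] := Yop_log a b; exists m, L => n k; rewrite YcoefE; exact: h.
Qed.

Definition Ysnd n k (y : tensor V (tensor V V)) : tensor V V := tmap id (Ycoef Y n k) y.
Definition Yfst n k (y : tensor V (tensor V V)) : tensor V V :=
  tmap (Ycoef Y n k) id (tassocV y).

Lemma Ysnd_lin n k : linear (Ysnd n k).
Proof. by apply: tmap_lin => //; exact: Ycoef_lin. Qed.

Lemma Yfst_lin n k : linear (Yfst n k).
Proof. by apply: comp_lin tassocV_lin; apply: tmap_lin => //; exact: Ycoef_lin. Qed.

Lemma YsndE n k a t : Ysnd n k (a ⊗ t) = a ⊗ Ycoef Y n k t.
Proof. by rewrite /Ysnd tmap_tens //; exact: Ycoef_lin. Qed.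

Lemma YfstE n k t c : Yfst n k (tassoc (t ⊗ c)) = Ycoef Y n k t ⊗ c.
Proof. by rewrite /Yfst tassocK tmap_tens //; exact: Ycoef_lin. Qed.

Lemma Ysnd_bound y : fam_bound Ysnd y.
Proof.
move: y; apply: tens_ind => [|s t|a t].
- exact: fam_bound0 Ysnd_lin.
- exact: fam_boundD Ysnd_lin.
have [m [L h]] := Ycoef_bound t; exists m, L => n k; rewrite YsndE => hn.
by apply: h; apply: contra_neq hn => ->; rewrite (lin0 (tens_linr a)).
Qed.

Lemma Yfst_bound y : fam_bound Yfst y.
Proof.
move: y; apply: tens3_ind => [|s t|a b c].
- exact: fam_bound0 Yfst_lin.
- exact: fam_boundD Yfst_lin.
have [m [L h]] := Ycoef_bound (a ⊗ b); exists m, L => n k.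
rewrite -tassocE YfstE => hn; apply: h; apply: contra_neq hn => ->.
by rewrite (lin0 (@tens_linl _ _ _ c)).
Qed.

Lemma Ysubst_single (zn : int -> expo -> K) zeta x e n0 p0 c :
  (forall n p, smul (zn n) (spow zeta p) e = if (n == n0) && (p == p0) then c else 0) ->
  Ysubst Y zn zeta x e = c *: Ycoef Y n0 p0 x.
Proof.
move=> h; rewrite /Ysubst -(fsbig_widen [set (n0, p0)]%classic) //.
  by rewrite fsbig_set1 /= h !eqxx.
move=> [n p] [_ /= hn]; rewrite h; case: ifP; last by rewrite scale0r.
by move=> /andP[/eqP e1 /eqP e2]; case: hn; rewrite e1 e2.
Qed.

Lemma Ysubst_z1 x i j k l : Ysubst Y z1 zeta1 x (i, j, (k, l))
  = if (j == 0) && (l == 0%N) then Ycoef Y i k x else 0.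
Proof.
rewrite (@Ysubst_single _ _ _ _ i k ((j == 0) && (l == 0%N))%:R).
  by case: (_ && _); rewrite ?scale1r ?scale0r.
move=> n p; rewrite spow_zeta1 /z1 smul_mono monoE !addr0 add0n.
rewrite [n == i]eq_sym [p == k]eq_sym.
by case: (i == n); case: (j == 0); case: (k == p); case: (l == 0%N).
Qed.

Lemma Ysubst_z2 x i j k l : Ysubst Y z2 zeta2 x (i, j, (k, l))
  = if (i == 0) && (k == 0%N) then Ycoef Y j l x else 0.
Proof.
rewrite (@Ysubst_single _ _ _ _ j l ((i == 0) && (k == 0%N))%:R).
  by case: (_ && _); rewrite ?scale1r ?scale0r.
move=> n p; rewrite spow_zeta2 /z2 smul_mono monoE !addr0 !add0n.
rewrite [n == j]eq_sym [p == l]eq_sym.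
by case: (i == 0); case: (j == n); case: (k == 0%N); case: (l == p).
Qed.

Lemma Ysubst_opp_z2 x i j k l : Ysubst Y opp_z2 zeta2 x (i, j, (k, l))
  = if (i == 0) && (k == 0%N) then (-1) ^ j *: Ycoef Y j l x else 0.
Proof.
rewrite (@Ysubst_single _ _ _ _ j l (if (i == 0) && (k == 0%N) then (-1) ^ j else 0)).
  by case: (_ && _); rewrite ?scale0r.
move=> n p; rewrite spow_zeta2 /opp_z2 smulZl /z2 smul_mono monoE !addr0 !add0n.
have [->|_] := eqVneq n j; last by rewrite andbF mulr0.
rewrite [p == l]eq_sym.
by case: (i == 0); case: (k == 0%N); case: (l == p); rewrite /= ?mulr1 ?mulr0.
Qed.

Lemma Ysubst_sw x : Ysubst Y z2 zeta2 x = Ysubst Y z1 zeta1 x \o sw.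
Proof. by apply/funext => -[[i j] [k l]]; rewrite /= Ysubst_z1 Ysubst_z2. Qed.

Lemma Ysubst_z1_lin e : linear (Ysubst Y z1 zeta1 ^~ e).
Proof.
case: e => [[i j] [k l]] c x y; rewrite !Ysubst_z1.
by case: ifP => _; rewrite ?Ycoef_lin ?scaler0 ?addr0.
Qed.

Lemma Ysubst_z2_lin e : linear (Ysubst Y z2 zeta2 ^~ e).
Proof.
case: e => [[i j] [k l]] c x y; rewrite !Ysubst_z2.
by case: ifP => _; rewrite ?Ycoef_lin ?scaler0 ?addr0.
Qed.

Lemma Ysubst_opp_z2_lin e : linear (Ysubst Y opp_z2 zeta2 ^~ e).
Proof.
case: e => [[i j] [k l]] c x y; rewrite !Ysubst_opp_z2.
by case: ifP => _; rewrite ?(scale_lin _ (Ycoef_lin _ _)) ?scaler0 ?addr0.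
Qed.

Lemma id_tens_z2 y i j k l : id_tens (Ysubst Y z2 zeta2) y (i, j, (k, l))
  = if (i == 0) && (k == 0%N) then Ysnd j l y else 0.
Proof.
rewrite /id_tens; under [X in tmap _ X]eq_fun do rewrite Ysubst_z2.
by case: ifP => _ //; exact: tmap0r.
Qed.

Lemma id_tens_opp_z2 y i j k l : id_tens (Ysubst Y opp_z2 zeta2) y (i, j, (k, l))
  = if (i == 0) && (k == 0%N) then (-1) ^ j *: Ysnd j l y else 0.
Proof.
rewrite /id_tens; under [X in tmap _ X]eq_fun do rewrite Ysubst_opp_z2.
by case: ifP => _; [apply: tmapZr; exact: Ycoef_lin | exact: tmap0r].
Qed.

Lemma tens_id_z2 y i j k l : tens_id (Ysubst Y z2 zeta2) y (i, j, (k, l))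
  = if (i == 0) && (k == 0%N) then Yfst j l y else 0.
Proof.
rewrite /tens_id; under [X in tmap X]eq_fun do rewrite Ysubst_z2.
by case: ifP => _ //; exact: tmap0l.
Qed.

Lemma id_tens_lin F e : (forall e, linear (F ^~ e)) ->
  linear (@id_tens K V F ^~ e).
Proof. by move=> Fl; apply: tmap_lin. Qed.

Lemma tens_id_lin F e : (forall e, linear (F ^~ e)) ->
  linear (@tens_id K V F ^~ e).
Proof. by move=> Fl; apply: comp_lin tassocV_lin; apply: tmap_lin. Qed.

Lemma head1_z1 : head1 (Ysubst Y z1 zeta1).
Proof.
move=> x; have [m [L h]] := Ycoef_bound x; exists m => -[[i j] [k l]].
rewrite Ysubst_z1; case: ifP => [/andP[/eqP -> _] /h|]; last by rewrite eqxx.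
by rewrite /= addr0 => -[].
Qed.

Lemma tail2_fam (U W : lmodType K) (G : U -> expo -> W) (f : int -> nat -> U -> W) :
  (forall y, fam_bound f y) ->
  (forall y i j k l, G y (i, j, (k, l)) != 0 ->
     [/\ i = 0, k = 0%N & f j l y != 0]) -> tail2 G.
Proof.
move=> fb hG y; have [m [L h]] := fb y; exists m, L => -[[i j] [k l]].
by move=> /hG[-> -> /h[]].
Qed.

Lemma tail2_z2 : tail2 (id_tens (Ysubst Y z2 zeta2)).
Proof.
apply: (tail2_fam Ysnd_bound) => y i j k l; rewrite id_tens_z2.
by case: ifP => [/andP[/eqP -> /eqP ->] h|]; rewrite ?eqxx.
Qed.

Lemma tail2_opp_z2 : tail2 (id_tens (Ysubst Y opp_z2 zeta2)).
Proof.
apply: (tail2_fam Ysnd_bound) => y i j k l; rewrite id_tens_opp_z2.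
case: ifP => [/andP[/eqP -> /eqP ->]|]; rewrite ?eqxx // scaler_eq0 negb_or.
by move=> /andP[].
Qed.

Lemma tail2_tens_z2 : tail2 (tens_id (Ysubst Y z2 zeta2)).
Proof.
apply: (tail2_fam Yfst_bound) => y i j k l; rewrite tens_id_z2.
by case: ifP => [/andP[/eqP -> /eqP ->] h|]; rewrite ?eqxx.
Qed.

Definition Yz1_Yz2 y := sapply (Ysubst Y z1 zeta1) (id_tens (Ysubst Y z2 zeta2) y).

Lemma Yz1_Yz2E y i j k l : Yz1_Yz2 y (i, j, (k, l)) = Ycoef Y i k (Ysnd j l y).
Proof.
rewrite /Yz1_Yz2 sapply_sep ?Ysubst_z1 ?id_tens_z2 ?eqxx //.
- by move=> e; exact: lin0 (Ysubst_z1_lin e).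
- move=> x [[i' j'] [k' l']]; rewrite Ysubst_z1.
  by case: ifP => [/andP[/eqP -> /eqP ->]|]; rewrite ?eqxx.
- move=> [[i' j'] [k' l']]; rewrite id_tens_z2.
  by case: ifP => [/andP[/eqP -> /eqP ->]|]; rewrite ?eqxx.
Qed.

Lemma Yz1_Yz2_lin e : linear (Yz1_Yz2 ^~ e).
Proof.
by case: e => [[i j] [k l]] c x y; rewrite !Yz1_Yz2E Ysnd_lin Ycoef_lin.
Qed.

Lemma lsupp_Yz1_Yz2 y : lsupp (Yz1_Yz2 y).
Proof.
apply/lsupp_sapply/head_tail; last exact: tail2_z2.
  by move=> e; exact: lin0 (Ysubst_z1_lin e).
exact: head1_z1.
Qed.

Definition z12_theta12 (N k : nat) : expo -> K := smul (spow z12 N) (spow theta12 k).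

Lemma lsupp_z12 : lsupp (z12 : expo -> K).
Proof. exact: taylor_lsupp taylor_z12. Qed.

Lemma lsupp_spow_z12 N : lsupp (spow z12 N : expo -> K).
Proof. exact: taylor_lsupp (taylor_pow N taylor_z12). Qed.

Lemma lsupp_spow_theta12 k : lsupp (spow theta12 k : expo -> K).
Proof. exact: taylor_lsupp (taylor_pow k taylor_theta12). Qed.

Lemma lsupp_z12_theta12 N k : lsupp (z12_theta12 N k).
Proof. exact: taylor_lsupp (taylor_z12_theta12 N k). Qed.

(* The left-hand side of locality. *)
Definition loc_series N y :=
  sapply (Ysubst Y z1 zeta1) (sapply (id_tens (Ysubst Y z2 zeta2))
    (sscale (spow z12 N) (sexp theta12 (on12 S) y))).

Lemma S12_nilp y : exists n, iter n (on12 S) y = 0.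
Proof. exact: on12_nilp braid_lin (@braid_nilp K V) y. Qed.

Lemma loc_seriesE N y n : iter n (on12 S) y = 0 -> loc_series N y = fun e =>
  \sum_(k < n) (k`!)%:R^-1 *: sscale (z12_theta12 N k) (Yz1_Yz2 (iter k (on12 S) y)) e.
Proof.
move=> hn; apply: sapply2_sexp => //.
- exact: Ysubst_z1_lin.
- by move=> e; apply: id_tens_lin; exact: Ysubst_z2_lin.
- exact: head1_z1.
- exact: tail2_z2.
- exact: lsupp_spow_z12.
- exact: lsupp_spow_theta12.
Qed.

Lemma loc_seriesD N x y e : loc_series N (x + y) e = loc_series N x e + loc_series N y e.
Proof.
have [n hn] := S12_nilp x; have [m hm] := S12_nilp y.
have hx := nilp_max S12l (leq_maxl n m) hn.
have hy := nilp_max S12l (leq_maxr n m) hm.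
have hxy : iter (maxn n m) (on12 S) (x + y) = 0.
  by rewrite (linD (iter_lin _ S12l)) hx hy addr0.
rewrite (loc_seriesE N hx) (loc_seriesE N hy) (loc_seriesE N hxy) -big_split; apply: eq_bigr => k _ /=.
rewrite -scalerDr -(sscaleDr e (lsupp_z12_theta12 N k) (lsupp_Yz1_Yz2 _) (lsupp_Yz1_Yz2 _));
  congr (_ *: sscale _ _ _).
by apply/funext => e'; rewrite (linD (iter_lin _ S12l)) (linD (Yz1_Yz2_lin e')).
Qed.

Lemma loc_seriesZ N c y e : loc_series N (c *: y) e = c *: loc_series N y e.
Proof.
have [n hn] := S12_nilp y.
have hc : iter n (on12 S) (c *: y) = 0.
  by rewrite (linZ (iter_lin _ S12l)) hn scaler0.
rewrite (loc_seriesE N hn) (loc_seriesE N hc) scaler_sumr; apply: eq_bigr => k _ /=.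
rewrite scalerA mulrC -scalerA.
rewrite -(sscaleZr c e (lsupp_z12_theta12 N k) (lsupp_Yz1_Yz2 _)).
congr (_ *: sscale _ _ _); apply/funext => e'.
by rewrite (linZ (iter_lin _ S12l)) (linZ (Yz1_Yz2_lin e')).
Qed.

Lemma loc_series0 N e : loc_series N 0 e = 0.
Proof. by apply: (@addrI _ (loc_series N 0 e)); rewrite -loc_seriesD !addr0. Qed.

Lemma loc_seriesS N y : loc_series N.+1 y = sscale z12 (loc_series N y).
Proof.
have [n hn] := S12_nilp y; rewrite (loc_seriesE N hn) (loc_seriesE N.+1 hn).
have hs k : lsupp (sscale (z12_theta12 N k) (Yz1_Yz2 (iter k (on12 S) y))).
  by apply: lsupp_sscale; [exact: lsupp_z12_theta12 | exact: lsupp_Yz1_Yz2].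
rewrite (@sscale_sum _ _ _ n (fun k e =>
  (k`!)%:R^-1 *: sscale (z12_theta12 N k) (Yz1_Yz2 (iter k (on12 S) y)) e)).
- apply/funext => e; apply: eq_bigr => k _; rewrite (sscaleZr _ _ lsupp_z12 (hs k)).
  rewrite (sscaleA lsupp_z12 (lsupp_z12_theta12 N k) (lsupp_Yz1_Yz2 _)).
  by rewrite (smulA lsupp_z12 (lsupp_spow_z12 N) (lsupp_spow_theta12 k)).
- exact: lsupp_z12.
- move=> k; apply: lpred_sub (hs k) => e.
  by apply: contra_neq => ->; rewrite scaler0.
Qed.

(** Stated for arbitrary fields and [A] because it serves both locality and the right-hand side of
    associativity. *)
Lemma swap_fields (U W X : lmodType K) (F F' : W -> expo -> X) (G G' : U -> expo -> W)
    (A : U -> U) N y :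
  (forall e, linear (F ^~ e)) -> (forall e, linear (G ^~ e)) ->
  (forall x, F' x = F x \o sw) -> (forall x, G' x = G x \o sw) ->
  sapply F' (sapply G' (sscale (spow z12 N) (sexp theta21 A y)))
  = fun e => (-1) ^+ N *:
      sapply F (sapply G (sscale (spow z12 N) (sexp theta12 A y))) (sw e).
Proof.
move=> Fl Gl hF hG.
have -> : F' = fun x => F x \o sw by apply/funext.
have -> : G' = fun x => G x \o sw by apply/funext.
have E : spow z12 N = (fun e => (-1) ^+ N * (spow z12 N \o sw) e) :> (expo -> K).
  by apply/funext => e; rewrite spow_z12_sw mulrA -expr2 sqrr_sign mul1r.
rewrite theta21_sw sexp_sw {1}E sscaleZl sscale_sw; set w := sscale _ _.
have -> : sapply (fun x => G x \o sw) (fun e => (-1) ^+ N *: (w \o sw) e)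
    = fun e => (-1) ^+ N *: (sapply G w \o sw) e.
  rewrite -sapply_sw; apply/funext => e; rewrite /sapply -fsum_scale.
  by apply: eq_fsbigr => p _ /=; rewrite (linZ (Gl _)).
set v := sapply G w; apply/funext => e.
rewrite -[sapply F v (sw e)]/((sapply F v \o sw) e) -sapply_sw /sapply -fsum_scale.
by apply: eq_fsbigr => p _ /=; rewrite (linZ (Fl _)).
Qed.

Lemma loc_series_swap N y :
  sapply (Ysubst Y z2 zeta2) (sapply (id_tens (Ysubst Y z1 zeta1))
    (sscale (spow z12 N) (sexp theta21 (on12 S) y)))
  = fun e => (-1) ^+ N *: loc_series N y (sw e).
Proof.
apply: swap_fields => [e|e|x|x].
- exact: Ysubst_z1_lin.
- by apply: id_tens_lin; exact: Ysubst_z2_lin.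
- exact: Ysubst_sw.
apply/funext => e; rewrite /id_tens /=; congr (tmap id _ x).
by apply/funext => t; rewrite Ysubst_sw /= swK.
Qed.

Lemma sscale_z12_sw (U : lmodType K) (w : expo -> U) e :
  sscale z12 (w \o sw) e = - sscale z12 w (sw e).
Proof.
have -> : z12 = (fun e => -1 * (z12 \o sw) e) :> (expo -> K).
  by apply/funext => e'; rewrite z12_sw mulN1r opprK.
rewrite sscaleZl sscale_sw scaleN1r; congr (- sscale _ _ _).
by apply/funext => e'; rewrite z12_sw mulN1r opprK.
Qed.

(** Locality freed of parities: P carries the sign of the exchange, and the right-hand side is the
    left-hand series of the flipped tensor in exchanged variables. The sign (-1)^N comes from
    z12^N. *)
Definition local_at N y := forall e,
  loc_series N y e = (-1) ^+ N *: loc_series N (on12 P y) (sw e).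

(** Different homogeneous summands of a tensor come with different N; this allows passing to the
    maximum. *)
Lemma local_at_leq N0 N y : (N0 <= N)%N -> local_at N0 y -> local_at N y.
Proof.
move=> /subnK <- h; elim: (N - N0)%N => //= m IHm e.
have -> : loc_series (m.+1 + N0) y e
    = sscale z12 (fun e => (-1) ^+ (m + N0) *: (loc_series (m + N0) (on12 P y) \o sw) e) e.
  by rewrite addSn loc_seriesS; congr sscale; apply/funext => e'; exact: IHm.
rewrite addSn loc_seriesS exprS mulN1r scaleNr -scalerN -sscale_z12_sw /sscale -fsum_scale.
by apply: eq_fsbigr => p _; rewrite !scalerA mulrC.
Qed.

(* The homogeneity assumptions of locality disappear once it is read as an
   identity of linear maps on the triple tensor product. *)
Lemma locality_lin y : exists N, local_at N y.
Proof.
move: y; apply: tens3_super_ind => [|s t [N hs] [M ht]|i j k a b c ha hb hc].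
- by exists 0%N => e; rewrite loc_series0 (lin0 (on12_lin flip_lin)) loc_series0 scaler0.
- exists (maxn N M) => e; rewrite (linD (on12_lin flip_lin)) !loc_seriesD scalerDr.
  by rewrite (local_at_leq (leq_maxl N M) hs) (local_at_leq (leq_maxr N M) ht).
have [N h] := locality ha hb; exists N => e.
have -> : on12 P (a ⊗ (b ⊗ c)) = (-1) ^+ (i && j) *: (b ⊗ (a ⊗ c)).
  rewrite -tassocE on12E; last exact: flip_lin.
  rewrite (flip_homog ha hb) (linZ (@tens_linl _ _ _ c)) (linZ tassoc_lin).
  by rewrite tassocE.
rewrite loc_seriesZ -[loc_series N _]/(sapply _ _) (h c) -/(loc_series _ _) loc_series_swap.
by rewrite !scalerA mulrC.
Qed.

End Fields.

(** * Skew-symmetry *)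

Section SkewSymmetry.
Context {K : numFieldType} {V : logVA K}.
Local Notation Y := (@Yop K V).
Local Notation S := (braid V).
Local Notation P := (@super_flip K V).
Local Notation T := (transl V).
Local Notation Yc := (Ycoef Y).

Lemma transl_lin : linear T.
Proof. by move=> c x y; rewrite linearP. Qed.

Lemma covariance_lin n k t : (n + 1)%:~R *: Yc (n + 1) k t + k.+1%:R *: Yc (n + 1) k.+1 t
  = T (Yc n k t) - Yc n k (tmap id T t).
Proof.
have Tl := transl_lin; have Yl n k := @Ycoef_lin K V n k.
have subl (U W : lmodType K) (f g : U -> W) : linear f -> linear g ->
    linear (fun x => f x - g x).
  by move=> fl gl c x y; rewrite fl gl scalerBr opprD addrACA.
move: t; apply: tens_ext.
- by apply: scale_add_lin; [exact: Yl | apply: scale_lin; exact: Yl].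
- by apply: subl; apply: comp_lin => //; exact: tmap_lin.
by move=> a b; rewrite tmap_tens // !YcoefE covariance.
Qed.

Lemma covariance_snd n k y :
  (n + 1)%:~R *: Ysnd (n + 1) k y + k.+1%:R *: Ysnd (n + 1) k.+1 y
  = tmap id T (Ysnd n k y) - Ysnd n k (tmap id (tmap id T) y).
Proof.
have Tl := transl_lin; have Yl n k := @Ysnd_lin K V n k.
have subl (U W : lmodType K) (f g : U -> W) : linear f -> linear g ->
    linear (fun x => f x - g x).
  by move=> fl gl c x z; rewrite fl gl scalerBr opprD addrACA.
have T2l : linear (tmap (@id V) T) by exact: tmap_lin.
move: y; apply: tens_ext.
- by apply: scale_add_lin; [exact: Yl | apply: scale_lin; exact: Yl].
- apply: subl; apply: comp_lin => //; exact: tmap_lin.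
move=> a t; rewrite tmap_tens // !YsndE tmap_tens //.
rewrite -!(linZ (tens_linr a)) -(linD (tens_linr a)) covariance_lin.
by rewrite (linD (tens_linr a)) -scaleN1r (linZ (tens_linr a)) scaleN1r.
Qed.

(** Covariance is used once for each field; the two terms with T between the fields cancel. *)
Lemma Delta_Yz1_Yz2 y e :
  Delta (Yz1_Yz2 y) e = T (Yz1_Yz2 y e) - Yz1_Yz2 (tmap id (tmap id T) y) e.
Proof.
case: e => [[i j] [k l]]; rewrite DeltaE !Yz1_Yz2E covariance_lin.
rewrite -!(linZ (Ycoef_lin _ _)) -(linD (Ycoef_lin _ _)) covariance_snd.
rewrite (linD (Ycoef_lin _ _)) addrA subrK -scaleN1r (linZ (Ycoef_lin _ _)).
by rewrite scaleN1r.
Qed.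

(** * Locality applied to the vacuum *)

Section Vacuum.
Variable t : tensor V V.
Local Notation x := (tassoc (t ⊗ vac V)).

(** The inner field creates from the vacuum a power series in z2 without ζ2, and the outer field
    involves neither variable. *)
Lemma Yz1_Yz2_vac_supp (s : tensor V V) e : Yz1_Yz2 (tassoc (s ⊗ vac V)) e != 0 ->
  0 <= e.1.2 /\ e.2.2 = 0%N.
Proof.
case: e => [[i j] [k l]]; rewrite Yz1_Yz2E /=;
  have [h _|h] := boolP ((0 <= j) && (l == 0%N)).
  by lia.
suff -> : Ysnd j l (tassoc (s ⊗ vac V)) = 0 by rewrite (lin0 (Ycoef_lin _ _)) eqxx.
move: s; apply: tens_ind => [|s1 s2 h1 h2|a b].
- by rewrite (lin0 (@tens_linl _ _ _ (vac V))) (lin0 tassoc_lin) (lin0 (Ysnd_lin _ _)).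
- rewrite (linD (@tens_linl _ _ _ (vac V))) (linD tassoc_lin) (linD (Ysnd_lin _ _)).
  by rewrite h1 h2 addr0.
by rewrite tassocE YsndE YcoefE vacuum_creation ?(lin0 (tens_linr a)) //; lia.
Qed.

Lemma Yz1_Yz2_vac0 (s : tensor V V) i k : Yz1_Yz2 (tassoc (s ⊗ vac V)) (i, 0, (k, 0%N)) = Yc i k s.
Proof.
rewrite Yz1_Yz2E; congr (Ycoef Y i k _); move: s; apply: tens_ext => //.
  apply: comp_lin (comp_lin (Ysnd_lin _ _) tassoc_lin) _; exact: tens_linl.
by move=> a b; rewrite tassocE YsndE YcoefE vacuum_value.
Qed.

Lemma Delta_Yz1_Yz2_vac (s : tensor V V) e :
  Delta (Yz1_Yz2 (tassoc (s ⊗ vac V))) e = T (Yz1_Yz2 (tassoc (s ⊗ vac V)) e).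
Proof.
have Tl := transl_lin; have T2l : linear (tmap (@id V) T) by exact: tmap_lin.
have E : tmap id (tmap id T) (tassoc (s ⊗ vac V)) = 0.
  have zl : linear (fun _ : tensor V V => 0 : tensor V (tensor V V)).
    by move=> c u v; rewrite scaler0 addr0.
  move: s; apply: (tens_ext _ zl).
    apply: comp_lin (comp_lin (tmap_lin _ T2l) tassoc_lin) _ => //.
    exact: tens_linl.
  move=> a b; rewrite tassocE !tmap_tens // transl_vac.
  by rewrite (lin0 (tens_linr b)) (lin0 (tens_linr a)).
by rewrite Delta_Yz1_Yz2 E (lin0 (Yz1_Yz2_lin e)) subr0.
Qed.

Lemma iter_S12_vac n : iter n (on12 S) x = tassoc (iter n S t ⊗ vac V).
Proof. exact: iter_on12E braid_lin n t (vac V). Qed.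

Lemma loc_series_vacE N : exists n0, forall n, (n0 <= n)%N -> loc_series N x = fun e =>
  \sum_(k < n) (k`!)%:R^-1 *: sscale (z12_theta12 N k) (Yz1_Yz2 (tassoc (iter k S t ⊗ vac V))) e.
Proof.
have [n0 h] := @S12_nilp K V x; exists n0 => n hn.
rewrite (loc_seriesE N (nilp_max (on12_lin braid_lin) hn h)); apply/funext => e.
by apply: eq_bigr => k _; rewrite iter_S12_vac.
Qed.

Lemma loc_series_vac_supp N e : loc_series N x e != 0 -> 0 <= e.1.2 /\ e.2.2 = 0%N.
Proof.
have [n /(_ n (leqnn n)) ->] := loc_series_vacE N;
  have [h _|h] := boolP ((0 <= e.1.2) && (e.2.2 == 0%N)).
  by lia.
rewrite big1 ?eqxx // => k _; apply/eqP; rewrite scaler_eq0; apply/orP; right.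
apply: contraNT h => /(sscale_taylor_supp (taylor_z12_theta12 N k) (@Yz1_Yz2_vac_supp _)).
by lia.
Qed.

(** At z2 = 0, z12^N becomes z1^N and ϑ12 becomes ζ1: this is a coefficient of z1^N Y(z1, ζ1) e^(ζ1
    S) t. *)
Lemma loc_series_vac0 N i p : loc_series N x (i, 0, (p, 0%N)) =
  \sum_(k < p.+1) (k`!)%:R^-1 *: Yc (i - N%:Z) (p - k)%N (iter k S t).
Proof.
(* The truncation lies beyond the nilpotency index and beyond p, the largest k contributing to
   ζ1^p. *)
have [n0 /(_ (maxn n0 p.+1) (leq_maxl _ _)) ->] := loc_series_vacE N.
rewrite (big_ord_widen _ (fun k => (k`!)%:R^-1 *: Yc (i - N%:Z) (p - k)%N (iter k S t))
  (leq_maxr n0 p.+1)) [RHS]big_mkcond; apply: eq_bigr => k _.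
rewrite (sscale_taylor0 _ _ _ (taylor_z12_theta12 N k)).
  rewrite -[(k < p.+1)%N]/(k <= p)%N.
  by case: ifP => _; rewrite ?Yz1_Yz2_vac0 ?scaler0.
by move=> e /Yz1_Yz2_vac_supp[].
Qed.

Lemma Delta_loc_series_vac N e : Delta (loc_series N x) e = T (loc_series N x e).
Proof.
have Tl := transl_lin; have [n /(_ n (leqnn n)) ->] := loc_series_vacE N.
set w := fun k : nat => sscale (z12_theta12 N k) (Yz1_Yz2 (tassoc (iter k S t ⊗ vac V))).
transitivity (\sum_(k < n) (k`!)%:R^-1 *: Delta (w k) e).
  rewrite /Delta /dshift !scaler_sumr -!big_split; apply: eq_bigr => k _ /=.
  by rewrite !scalerDr !scalerA ![_^-1 * _]mulrC.
rewrite (lin_sum Tl); apply: eq_bigr => k _; rewrite (linZ Tl); congr (_ *: _).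
have hz := @lsupp_z12_theta12 K N k.
have hy := lsupp_Yz1_Yz2 (tassoc (iter k S t ⊗ vac V)).
rewrite Delta_sscale // [X in X + _](_ : _ = 0) ?add0r.
  have -> : Delta (Yz1_Yz2 (tassoc (iter k S t ⊗ vac V)))
      = T \o Yz1_Yz2 (tassoc (iter k S t ⊗ vac V)).
    by apply/funext => e'; exact: Delta_Yz1_Yz2_vac.
  by rewrite sscale_lin.
have [_ _ D0] := taylor_z12_theta12 (K := K) N k.
by apply: fsbig1 => p _; rewrite D0 scale0r.
Qed.

End Vacuum.

Lemma flip_vac t : on12 P (tassoc (t ⊗ vac V)) = tassoc (P t ⊗ vac V).
Proof. by rewrite on12E //; exact: flip_lin. Qed.

(** By locality the series is, up to sign, the swap of one free of ζ2. Hence it is free of ζ1, and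
    so is its restriction z1^N Y(z1, ζ1) e^(ζ1 S) t. *)
Lemma Ycoef_braid_sum n p t : (0 < p)%N ->
  \sum_(k < p.+1) (k`!)%:R^-1 *: Yc n (p - k)%N (iter k S t) = 0.
Proof.
move=> p0; have [N hN] := locality_lin (tassoc (t ⊗ vac V)).
have := loc_series_vac0 t N (n + N%:Z) p; rewrite addrK => <-.
rewrite hN flip_vac; apply/eqP; rewrite scaler_eq0; apply/orP; right.
by apply/negPn/negP => /loc_series_vac_supp /= [_ hp]; rewrite hp in p0.
Qed.

(* The series Y(z,ζ) e^(ζ S) does not depend on ζ. *)
Lemma Ycoef_zeta n p t : p.+1%:R *: Yc n p.+1 t = - Yc n p (S t).
Proof.
apply/eqP; rewrite -addr_eq0 addrC; apply/eqP.
elim/ltn_ind: p t => p IHp t.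
have := Ycoef_braid_sum n t (ltn0Sn p).
move/(congr1 (fun u => p.+1%:R *: u)); rewrite scaler0.
rewrite (binomial_rec (fun k q => (k`!)%:R^-1 *: Yc n q (iter k S t))).
(* The terms now come in pairs. The pair of index k + 1 is a multiple of the induction hypothesis at
   p - (k + 1) for the vector S^(k+1) t, so only the pair of index 0 survives. *)
rewrite -big_split /= big_ord_recl /= big1 ?addr0; last first.
  move=> k _; rewrite /bump /= add1n.
  have kp : (p - k.+1 < p)%N by have := ltn_ord k; lia.
  have := IHp _ kp (iter k.+1 S t); rewrite -subSn ?ltn_ord // subSS.
  move=> /(congr1 (fun u => (k.+1`!)%:R^-1 *: u)); rewrite scaler0 => <-.
  rewrite scalerDr !scalerA; congr (_ *: _ + _ *: _); last by rewrite mulrC.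
  rewrite factS natrM invfM mulrA mulfV ?mul1r //; last by rewrite pnatr_eq0.
by rewrite !subn0 fact0 invr1 !scale1r.
Qed.

(** In closed form, Y(z, ζ) = Y(z, 0) e^(-ζ S): the field is determined by its part free of ζ. *)
Lemma Ycoef_zeta0 n p t : Yc n p t = ((-1) ^+ p / (p`!)%:R) *: Yc n 0 (iter p S t).
Proof.
elim: p t => [|p IHp] t; first by rewrite fact0 divr1 scale1r.
have p0 : p.+1%:R != 0 :> K by rewrite pnatr_eq0.
apply: (scalerI p0); rewrite Ycoef_zeta IHp -iterSr -scaleNr scalerA; congr (_ *: _).
rewrite factS natrM exprS mulN1r !mulNr mulrN; congr (- _).
by rewrite mulrCA invfM mulVKf.
Qed.

Lemma iter_transl_lin s : linear (iter s T).
Proof. by apply: iter_lin; exact: transl_lin. Qed.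

(** The solution of (∂1 + ∂2) Q = T Q is Q(z1, z2) = e^(z1 T) Q(0, z2 - z1); the right-hand side is
    its coefficient of z1^i z2^j. *)
Lemma power_series_flow (Qn : nat -> nat -> V) :
  (forall i j, i.+1%:R *: Qn i.+1 j + j.+1%:R *: Qn i j.+1 = T (Qn i j)) ->
  forall i j, Qn i j = \sum_(s < i.+1)
    ((s`!)%:R^-1 * ((-1) ^+ (i - s) * 'C(j + (i - s), i - s)%:R)) *:
      iter s T (Qn 0%N (j + (i - s))%N).
Proof.
move=> h; pose d (j s r : nat) : V :=
  ((s`!)%:R^-1 * ((-1) ^+ r * 'C(j + r, r)%:R)) *: iter s T (Qn 0%N (j + r)%N).
elim=> [|i IHi] j.
  by rewrite big_ord1 /= subn0 addn0 bin0 fact0 invr1 !mulr1 scale1r.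
have i0 : i.+1%:R != 0 :> K by rewrite pnatr_eq0.
apply: (scalerI i0); rewrite (binomial_rec (d j)).
apply: (addIr (j.+1%:R *: Qn i j.+1)); rewrite h (IHi j) (lin_sum transl_lin).
rewrite (IHi j.+1) scaler_sumr -addrA -big_split /= [X in _ + X]big1 ?addr0.
  apply: eq_bigr => s _; rewrite (linZ transl_lin) scalerA; congr (_ *: _).
  by rewrite factS natrM invfM -!mulrA mulVKf // pnatr_eq0.
(* What is left cancels by (r + 1) C(j + r + 1, r + 1) = (j + 1) C(j + r + 1, r). *)
move=> s _; rewrite /d !scalerA addSnnS -scalerDl [X in X *: _](_ : _ = 0) ?scale0r //.
set r := (i - s)%N; rewrite exprS mulN1r !mulNr !mulrN addrC.
apply/eqP; rewrite subr_eq0; apply/eqP.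
rewrite mulrCA [RHS]mulrCA; congr (_ * _); rewrite mulrCA [RHS]mulrCA; congr (_ * _).
by rewrite -!natrM mul_bin_left addnS subSn ?leq_addl // addnK.
Qed.

End SkewSymmetry.

Section Sign.
Context {K : numFieldType}.

Lemma signzD (m n : int) : (-1) ^ (m + n) = (-1) ^ m * (-1) ^ n :> K.
Proof. by rewrite expfzDr // oppr_eq0 oner_eq0. Qed.

Lemma signzN (n : int) : (-1) ^ (- n) = (-1) ^ n :> K.
Proof. by rewrite -exprz_inv invrN1. Qed.

End Sign.

Section Associativity.
Context {K : numFieldType} {V : logVA K}.
Local Notation Y := (@Yop K V).
Local Notation S := (braid V).
Local Notation P := (@super_flip K V).
Local Notation T := (transl V).
Local Notation Yc := (Ycoef Y).

(** The series Q of locality has Q(z1, 0) = z1^N Y(z1, 0) t and Q(0, z2) = (-1)^N z2^N Y(z2, 0) P t.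
    The flow evaluates the second at -z1, where (-1)^N turns (-z1)^N into z1^N. The truncation M is
    left free past the last nonzero term, so that later sums can share one bound. *)
Lemma skew_symmetry0 t : exists N : nat, forall (n : int) (M : nat), n + N%:Z < M%:Z ->
  Yc n 0 t = \sum_(s < M) ((s`!)%:R^-1 * (-1) ^ (n - s%:Z)) *:
    iter s T (Yc (n - s%:Z) 0 (P t)).
Proof.
have [N hN] := locality_lin (tassoc (t ⊗ vac V)); exists N => n M hM.
set x := tassoc (t ⊗ vac V) in hN; pose x' := tassoc (P t ⊗ vac V).
have hx e : loc_series N x e = (-1) ^+ N *: loc_series N x' (sw e) by rewrite hN flip_vac.
have hx' e : loc_series N x' e = (-1) ^+ N *: loc_series N x (sw e).
  by rewrite hx swK scalerA -expr2 sqrr_sign scale1r.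
have Yx i : loc_series N x (i, 0, (0%N, 0%N)) = Yc (i - N%:Z) 0 t.
  by rewrite loc_series_vac0 big_ord1 fact0 invr1 scale1r.
have Yx' i : loc_series N x' (i, 0, (0%N, 0%N)) = Yc (i - N%:Z) 0 (P t).
  by rewrite loc_series_vac0 big_ord1 fact0 invr1 scale1r.
(* Locality excludes negative powers of z1 from the series, so its N also bounds the pole of Y(z, 0)
   t, and likewise for P t. *)
have neg i : i < 0 -> Yc (i - N%:Z) 0 t = 0.
  move=> i0; rewrite -Yx hx; apply/eqP; rewrite scaler_eq0; apply/orP; right.
  by apply/negPn/negP => /loc_series_vac_supp /= [h _]; lia.
have neg' i : i < 0 -> Yc (i - N%:Z) 0 (P t) = 0.
  move=> i0; rewrite -Yx' hx'; apply/eqP; rewrite scaler_eq0; apply/orP; right.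
  by apply/negPn/negP => /loc_series_vac_supp /= [h _]; lia.
have [n0|n0] := ltP (n + N%:Z) 0.
  rewrite -[n](addrK N%:Z) neg // big1 // => s _; rewrite addrAC neg' ?scaler0 //.
    by rewrite (lin0 (iter_transl_lin _)) scaler0.
  by lia.
have [i ni] : exists i : nat, n = i%:Z - N%:Z by exists (absz (n + N%:Z)); lia.
rewrite {n}ni in hM n0 *.
pose Qn (a b : nat) := loc_series N x (a%:Z, b%:Z, (0%N, 0%N)).
(* In the absence of ζ1 and ζ2, [Delta] is ∂1 + ∂2. *)
have flow a b : a.+1%:R *: Qn a.+1 b + b.+1%:R *: Qn a b.+1 = T (Qn a b).
  rewrite -Delta_loc_series_vac DeltaE /Qn -!PoszD !addn1.
  have -> : loc_series N x (a.+1%:Z, b%:Z, (1%N, 0%N)) = 0.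
    rewrite hx; apply/eqP; rewrite scaler_eq0; apply/orP; right.
    by apply/negPn/negP => /loc_series_vac_supp /= [].
  have -> : loc_series N x (a%:Z, b.+1%:Z, (0%N, 1%N)) = 0.
    by apply/eqP/negPn/negP => /loc_series_vac_supp /= [].
  by rewrite !scaler0 !addr0.
rewrite -Yx -[LHS]/(Qn i 0%N) (power_series_flow flow).
have iM : (i.+1 <= M)%N by lia.
rewrite (big_ord_widen _ (fun s => ((s`!)%:R^-1 * ((-1) ^+ (i - s) * 'C(0 + (i - s), i - s)%:R)) *:
      iter s T (Qn 0 (0 + (i - s)))%N) iM) big_mkcond.
apply: eq_bigr => s _ /=; rewrite add0n binn mulr1 /Qn hx -[sw _]/(_, _, (_, _)) /= Yx'.
case: ifP => his.
  rewrite (linZ (iter_transl_lin _)) scalerA -mulrA; congr (_ * _ *: iter s T (Ycoef Y _ _ _)).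
    have -> : i%:Z - N%:Z - s%:Z = (i - s)%N%:Z - N%:Z by lia.
    by rewrite signzD signzN.
  by lia.
rewrite (_ : i%:Z - N%:Z - s%:Z = (i%:Z - s%:Z) - N%:Z); last by lia.
by rewrite neg' ?(lin0 (iter_transl_lin _)) ?scaler0 //; lia.
Qed.

Lemma iter_flip_braid n t : iter n S (P t) = P (iter n S t).
Proof. by elim: n => //= n ->; rewrite (braiding_flip (braid_braiding V)). Qed.

(** Both sides depend on ζ through e^(-ζ S), which commutes with P. *)
Lemma skew_symmetry p t : exists N : nat, forall (n : int) (M : nat), n + N%:Z < M%:Z ->
  Yc n p t = \sum_(s < M) ((s`!)%:R^-1 * (-1) ^ (n - s%:Z)) *:
    iter s T (Yc (n - s%:Z) p (P t)).
Proof.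
have [N h] := skew_symmetry0 (iter p S t); exists N => n M /h E.
rewrite [LHS]Ycoef_zeta0 E scaler_sumr; apply: eq_bigr => s _.
rewrite [in RHS]Ycoef_zeta0 iter_flip_braid (linZ (iter_transl_lin _)) !scalerA.
by rewrite mulrC.
Qed.

Definition T2 : tensor V V -> tensor V V := tmap id T.

Lemma iter_T2E s a b : iter s T2 (a ⊗ b) = a ⊗ iter s T b.
Proof. by elim: s => //= s ->; rewrite /T2 tmap_tens //; exact: transl_lin. Qed.

Lemma T2_lin : linear T2.
Proof. by apply: tmap_lin => //; exact: transl_lin. Qed.

Lemma iter_T2_lin s : linear (iter s T2).
Proof. by apply: iter_lin; exact: T2_lin. Qed.

Lemma skew_symmetry_snd p y : exists N : nat, forall (n : int) (M : nat), n + N%:Z < M%:Z ->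
  Ysnd n p (on23 P y) = \sum_(s < M) ((s`!)%:R^-1 * (-1) ^ (n - s%:Z)) *:
    iter s T2 (Ysnd (n - s%:Z) p y).
Proof.
have Pl := on23_lin (@flip_lin K V).
move: y; apply: tens_ind => [|y z [N hy] [N' hz]|a t].
- exists 0%N => n M _; rewrite (lin0 Pl) (lin0 (Ysnd_lin _ _)) big1 // => s _.
  by rewrite (lin0 (Ysnd_lin _ _)) (lin0 (iter_T2_lin _)) scaler0.
- exists (N + N')%N => n M h; rewrite (linD Pl) (linD (Ysnd_lin _ _)) (hy n M) ?(hz n M);
    try lia.
  rewrite -big_split; apply: eq_bigr => s _ /=.
  by rewrite (linD (Ysnd_lin _ _)) (linD (iter_T2_lin _)) scalerDr.
have [N h] := skew_symmetry p (P t); exists N => n M /h {}h.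
rewrite on23E; last exact: flip_lin.
rewrite [LHS](YsndE n p a (P t)) h (lin_sum (tens_linr a)); apply: eq_bigr => s _.
by rewrite (linZ (tens_linr a)) YsndE iter_T2E flipK.
Qed.

(** * The field at z12, expanded in powers of z2 *)

Local Notation Y12 := (Ysubst Y iota_z12 theta12).

(** The expansion of z12^n ϑ12^q is homogeneous of degree n in z1, z2, so only n = i + j
    contributes. *)
Lemma Ysubst_z12E x L i j k l : (forall n q, (L <= q)%N -> Yc n q x = 0) ->
  Y12 x (i, j, (k, l)) = \sum_(q < L)
    smul (iota_z12 (i + j)) (spow theta12 q) (i, j, (k, l)) *: Yc (i + j) q x.
Proof.
move=> hL; rewrite /Ysubst (fsbigE [seq (i + j, q) | q <- iota 0 L]) //.
- rewrite big_mkcond big_map -(big_mkord xpredT (fun q =>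
    smul (iota_z12 (i + j)) (spow theta12 q) (i, j, (k, l)) *: Yc (i + j) q x)).
  by rewrite /index_iota subn0; apply: eq_bigr => q _; rewrite in_setT.
- by rewrite map_inj_uniq ?iota_uniq // => p q [].
move=> [n q] _ hn; have [tn _ _] := @taylor_iota K n q.
apply/eqP; rewrite scaler_eq0 /=; apply/orP.
have [?|hne] := eqVneq (i + j) n; last first.
  by left; apply: contraTT hne => /tn /= [_ -> _]; rewrite eqxx.
right; apply/eqP/hL; rewrite leqNgt; apply: contra hn => hq; subst n.
by rewrite map_f // mem_iota.
Qed.

Lemma Ycoef_zeta_bound x : exists L, forall n q, (L <= q)%N -> Yc n q x = 0.
Proof.
have [m [L h]] := Ycoef_bound x; exists L => n q hq.
by apply/eqP/negPn/negP => /h [_]; lia.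
Qed.

Lemma Ysubst_z12_lin e : linear (Y12 ^~ e).
Proof.
case: e => [[i j] [k l]] c x y.
have [L hx] := Ycoef_zeta_bound x; have [L' hy] := Ycoef_zeta_bound y.
have hx' n q : (maxn L L' <= q)%N -> Yc n q x = 0 by move=> hq; apply: hx; lia.
have hy' n q : (maxn L L' <= q)%N -> Yc n q y = 0 by move=> hq; apply: hy; lia.
have hxy n q : (maxn L L' <= q)%N -> Yc n q (c *: x + y) = 0.
  by move=> hq; rewrite Ycoef_lin hx' // hy' // scaler0 addr0.
rewrite (Ysubst_z12E _ _ _ _ hx') (Ysubst_z12E _ _ _ _ hy') (Ysubst_z12E _ _ _ _ hxy).
rewrite scaler_sumr -big_split; apply: eq_bigr => q _ /=.
by rewrite Ycoef_lin scalerDr !scalerA mulrC.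
Qed.

Lemma Ysubst_z12_supp x e : Y12 x e != 0 -> 0 <= e.1.2 /\ e.2.2 = 0%N.
Proof.
case: e => [[i j] [k l]]; have [L hL] := Ycoef_zeta_bound x.
rewrite (Ysubst_z12E _ _ _ _ hL);
  have [h _|h] := boolP ((0 <= j) && (l == 0%N)).
  by rewrite /=; lia.
rewrite big1 ?eqxx // => q _; have [tn _ _] := @taylor_iota K (i + j) q.
apply/eqP; rewrite scaler_eq0; apply/orP; left; apply: contraNT h => /tn [/= h1 _ h2].
by lia.
Qed.

Lemma head1_z12 : head1 Y12.
Proof.
move=> x; have [m [L h]] := Ycoef_bound x; exists m => e he.
split; first by case: (Ysubst_z12_supp he).
move: he; case: e => [[i j] [k l]]; have [L' hL] := Ycoef_zeta_bound x.
rewrite (Ysubst_z12E _ _ _ _ hL) /= leNgt; apply: contraNN => hij.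
rewrite big1 // => q _; apply/eqP; rewrite scaler_eq0; apply/orP; right.
by apply/negPn/negP => /h []; lia.
Qed.

Lemma Ysubst_z12_0 x i k : Y12 x (i, 0, (k, 0%N)) = Yc i k x.
Proof.
have [L hL] := Ycoef_zeta_bound x; rewrite (Ysubst_z12E _ _ _ _ hL) addr0.
have [hk|hk] := leqP L k.
  rewrite hL // big1 // => q _; have [_ t0 _] := @taylor_iota K i q.
  rewrite t0 monoE; have -> : (k == q) = false by have := ltn_ord q; lia.
  by rewrite !andbF scale0r.
rewrite (bigD1 (Ordinal hk)) //= big1 => [|q hq].
  have [_ t0 _] := @taylor_iota K i k.
  by rewrite t0 monoE !eqxx scale1r addr0.
have [_ t0 _] := @taylor_iota K i q; rewrite t0 monoE.
have -> : (k == q) = false by apply/negbTE; apply: contra hq => /eqP kq; apply/eqP/val_inj.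
by rewrite !andbF scale0r.
Qed.

Lemma Delta_z12 x e : Delta (Y12 x) e = 0.
Proof.
case: e => [[i j] [k l]]; have [L hL] := Ycoef_zeta_bound x.
rewrite DeltaE !(Ysubst_z12E _ _ _ _ hL).
rewrite [i + (j + 1)]addrA [i + 1 + j]addrAC !scaler_sumr -!big_split big1 // => q _ /=.
rewrite !scalerA -!scalerDl.
have [_ _ /(_ (i, j, (k, l)))] := @taylor_iota K (i + j + 1) q.
by rewrite DeltaE => h; rewrite [X in X *: _]h scale0r.
Qed.

Lemma Ysubst_z12_rec x (j : nat) i k :
  j.+1%:R *: Y12 x (i, j.+1%:Z, (k, 0%N))
  = - ((i + 1)%:~R *: Y12 x (i + 1, j%:Z, (k, 0%N))
       + k.+1%:R *: Y12 x (i + 1, j%:Z, (k.+1, 0%N))).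
Proof.
have := Delta_z12 x (i, j%:Z, (k, 0%N)); rewrite DeltaE -!PoszD !addn1.
have -> : Y12 x (i, j.+1%:Z, (k, 1%N)) = 0.
  by apply/eqP/negPn/negP => /Ysubst_z12_supp /= [].
by rewrite scaler0 addr0 => /eqP; rewrite addrC addr_eq0 => /eqP.
Qed.

(** Covariance at z12, where ∂_z2 acts as -D. At z2 = 0 it is covariance of Y(z1), and the vanishing
    of [Delta] carries it up one power of z2 at a time. *)
Lemma Ysubst_z12_step x i k (j : nat) :
  j.+1%:R *: Y12 x (i, j.+1%:Z, (k, 0%N))
  = Y12 (T2 x) (i, j%:Z, (k, 0%N)) - T (Y12 x (i, j%:Z, (k, 0%N))).
Proof.
(* A1 and A2 are the coefficients of z2^(j+1) to which the recursion leads. Multiplied by r = j + 1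
   they descend to z2^j by induction, and there the recursions for [T2 x] and for x reassemble them
   into C and D. *)
have cancel_step (r u v : K) (A B A1 A2 B1 B2 C D : V) : r != 0 ->
    r *: A1 = B1 - T A -> r *: A2 = B2 - T B ->
    r *: C = - (u *: B1 + v *: B2) -> r *: D = - (u *: A + v *: B) ->
    - (u *: A1 + v *: A2) = C - T D.
  move=> r0 h1 h2 h3 h4; apply: (scalerI r0).
  have TN : T (- (u *: A + v *: B)) = - (u *: T A + v *: T B).
    by rewrite -scaleN1r (linZ transl_lin) (linD transl_lin) !(linZ transl_lin) scaleN1r.
  have e1 : r *: (u *: A1) = u *: (B1 - T A) by rewrite scalerA mulrC -scalerA h1.
  have e2 : r *: (v *: A2) = v *: (B2 - T B) by rewrite scalerA mulrC -scalerA h2.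
  rewrite scalerN scalerDr e1 e2 [RHS]scalerBr -(linZ transl_lin) h3 h4 TN opprK.
  by rewrite !scalerBr addrACA -opprD opprB [LHS]addrC.
elim: j i k => [|j IHj] i k; rewrite Ysubst_z12_rec.
  by rewrite !Ysubst_z12_0 covariance_lin opprB.
apply: (cancel_step j.+1%:R) (IHj _ _) (IHj _ _) _ _; first by rewrite pnatr_eq0.
  exact: Ysubst_z12_rec.
exact: Ysubst_z12_rec.
Qed.

End Associativity.

(** * Associativity *)

Lemma triangle_sum (U : nmodType) (f : nat -> nat -> U) M :
  \sum_(s < M) \sum_(r < M - s) f s r = \sum_(p < M) \sum_(s < p.+1) f s (p - s)%N.
Proof.
elim: M => [|M IHM]; first by rewrite !big_ord0.
rewrite [RHS]big_ord_recr /= -IHM.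
transitivity (\sum_(s < M.+1) (\sum_(r < M - s) f s r + f s (M - s)%N)).
  by apply: eq_bigr => s _; rewrite subSn -1?ltnS // big_ord_recr.
by rewrite big_split /= [X in X + _]big_ord_recr /= subnn big_ord0 addr0.
Qed.

Lemma signz_sq {K : numFieldType} (n : int) : (-1) ^ n * (-1) ^ n = 1 :> K.
Proof. by rewrite -{2}signzN -signzD subrr. Qed.

Section Exponential.
Context {K : numFieldType} {V : logVA K}.
Local Notation Y := (@Yop K V).
Local Notation S := (braid V).
Local Notation P := (@super_flip K V).
Local Notation T := (transl V).
Local Notation Yc := (Ycoef Y).
Local Notation Y12 := (Ysubst Y iota_z12 theta12).

(** The coefficient of z2^p in e^(-z2 T) Y(z1) (I ⊗ e^(z2 T)), obtained by integrating
    [Ysubst_z12_step] from z2 = 0. *)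
Lemma Ysubst_z12_taylor p x i k : Y12 x (i, p%:Z, (k, 0%N)) =
  \sum_(s < p.+1) ((-1) ^+ s / (s`! * (p - s)`!)%:R) *:
     iter s T (Yc i k (iter (p - s) T2 x)).
Proof.
elim: p x => [|p IHp] x.
  by rewrite Ysubst_z12_0 big_ord1 /= fact0 divr1 scale1r.
have p0 : p.+1%:R != 0 :> K by rewrite pnatr_eq0.
apply: (scalerI p0); rewrite Ysubst_z12_step !IHp.
rewrite (binomial_rec (fun s q => ((-1) ^+ s / (s`! * q`!)%:R) *:
     iter s T (Yc i k (iter q T2 x)))) addrC.
congr (_ + _).
  rewrite (lin_sum transl_lin) -sumrN; apply: eq_bigr => s _.
  rewrite (linZ transl_lin) scalerA -scaleNr; congr (_ *: _).
  rewrite factS exprS mulN1r -mulnA [in RHS]natrM [in RHS]invfM mulNr mulrN; congr (- _).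
  by rewrite [RHS]mulrCA mulVKf // pnatr_eq0.
apply: eq_bigr => s _; rewrite -iterSr scalerA; congr (_ *: _).
by rewrite factS mulnCA [in RHS]natrM [in RHS]invfM [RHS]mulrCA mulVKf // pnatr_eq0.
Qed.

(* e^(-z2 T) *)
Definition expNT2 (x : V) : expo -> V := fun e =>
  if [&& e.1.1 == 0, 0 <= e.1.2, e.2.1 == 0%N & e.2.2 == 0%N]
  then ((-1) ^+ absz e.1.2 / ((absz e.1.2)`!)%:R) *: iter (absz e.1.2) T x else 0.

Lemma expNT2_lin e : linear (expNT2 ^~ e).
Proof.
move=> c x y; rewrite /expNT2; case: ifP => _; last by rewrite scaler0 addr0.
by rewrite (scale_lin _ (iter_transl_lin _)).
Qed.

Lemma sapply_expNT2 (g : expo -> V) M (i j : int) k l :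
  (forall s : nat, (M <= s)%N -> g (i, j - s%:Z, (k, l)) = 0) ->
  sapply expNT2 g (i, j, (k, l)) =
  \sum_(s < M) ((-1) ^+ s / (s`!)%:R) *: iter s T (g (i, j - s%:Z, (k, l))).
Proof.
move=> hg; rewrite /sapply.
pose r : seq (expo * expo) :=
  [seq ((0, s%:Z, (0%N, 0%N)), (i, j - s%:Z, (k, l))) | s <- iota 0 M].
have rE a b : a + b = (i, j, (k, l)) -> a.1.1 = 0 -> 0 <= a.1.2 -> a.2 = (0%N, 0%N) ->
    (absz a.1.2 < M)%N -> (a, b) \in r.
  case: a b => [[a1 a2] [a3 a4]] [[b1 b2] [b3 b4]]; rewrite expoDE /=.
  move=> [h1 h2 h3 h4] h5 h6 [h7 h8] h9; apply/mapP; exists (absz a2).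
    by rewrite mem_iota.
  by congr (_, _, (_, _), (_, _, (_, _))); lia.
rewrite (fsbigE r) //.
- rewrite big_mkcond big_map -(big_mkord xpredT (fun s =>
    ((-1) ^+ s / (s`!)%:R) *: iter s T (g (i, j - s%:Z, (k, l))))).
  rewrite /index_iota subn0; apply: eq_bigr => s _; rewrite ifT.
    by [].
  by rewrite inE /splits /= expoDE /= add0r [_ + (j - _)]addrC subrK.
- by rewrite map_inj_uniq ?iota_uniq // => p q [].
- move=> p /mapP[s _ ->]; rewrite /splits /= expoDE /= add0r.
  by rewrite [_ + (j - _)]addrC subrK.
move=> [a b] hab hn; rewrite /expNT2 /=; case: ifP => // /and4P[/eqP a0 a1 /eqP a2 /eqP a3].
have hs : (M <= absz a.1.2)%N.
  by rewrite leqNgt; apply: contra hn => h; apply: rE => //; case: (a.2) a2 a3 => ? ? /= -> ->.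
suff -> : b = (i, j - (absz a.1.2)%:Z, (k, l)).
  by rewrite hg // (lin0 (iter_transl_lin _)) scaler0.
move: hab a0 a1 a2 a3 {hn hs}; case: a b => [[a1 a2] [a3 a4]] [[b1 b2] [b3 b4]].
rewrite /splits /= expoDE /= => -[h1 h2 h3 h4] ? ? ? ?.
by congr (_, _, (_, _)); lia.
Qed.

Lemma jpred_expNT2 (g : expo -> V) : lsupp g -> jpred (fun a b => expNT2 (g b) a != 0).
Proof.
move=> hg; pose A (a : expo) := a.1.1 = 0 /\ 0 <= a.1.2.
have hA : lpred A by exists 0 => v; exists 0 => a [-> ?].
apply: jpred_sub (jpred_prod hA hg) => a b h; split; last first.
  by apply: contra_neq h => ->; exact: lin0 (expNT2_lin a).
by move: h; rewrite /expNT2; case: ifP => [/and4P[/eqP ? ? _ _] _|]; rewrite ?eqxx.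
Qed.

(** e^(-z1 T), which appears on the right-hand side once the variables are exchanged. *)
Definition expNT1 (x : V) : expo -> V := expNT2 x \o sw.

Lemma expNT1_lin e : linear (expNT1 ^~ e).
Proof. exact: expNT2_lin. Qed.

Lemma sapply_expNT1 (g : expo -> V) :
  sapply expNT1 g = sapply expNT2 (g \o sw) \o sw.
Proof.
by rewrite -sapply_sw; congr sapply; apply/funext => e /=; rewrite swK.
Qed.

Lemma jpred_expNT1 (g : expo -> V) : lsupp g -> jpred (fun a b => expNT1 (g b) a != 0).
Proof.
move=> hg; pose A (a : expo) := 0 <= a.1.1 /\ a.1.2 = 0.
have hA : lpred A by exists 0 => v; exists 0 => a [? ->].
apply: jpred_sub (jpred_prod hA hg) => a b h; split; last first.
  by apply: contra_neq h => ->; exact: lin0 (expNT1_lin a).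
move: h; rewrite /expNT1 /expNT2 /=.
by case: ifP => [/and4P[/eqP ? ? _ _] _|]; rewrite ?eqxx.
Qed.

Lemma sapply_loc_series (E : V -> expo -> V) N y n : (forall e, linear (E ^~ e)) ->
  (forall g : expo -> V, lsupp g -> jpred (fun a b => E (g b) a != 0)) ->
  iter n (on12 S) y = 0 -> sapply E (loc_series N y) = fun e =>
  \sum_(k < n) (k`!)%:R^-1 *: sscale (z12_theta12 N k) (sapply E (Yz1_Yz2 (iter k (on12 S) y))) e.
Proof.
move=> El hE hn; rewrite (loc_seriesE N hn).
pose w k := sscale (z12_theta12 N k) (Yz1_Yz2 (iter k (on12 S) y)).
have hw k : lsupp (w k) by apply: lsupp_sscale; [exact: lsupp_z12_theta12 | exact: lsupp_Yz1_Yz2].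
rewrite (@sapply_sum _ _ _ E El n (fun k e => (k`!)%:R^-1 *: w k e)); last first.
  move=> k; apply: hE; apply: lpred_sub (hw k) => e.
  by apply: contra_neq => ->; rewrite scaler0.
apply/funext => e; apply: eq_bigr => k _; rewrite sapplyZ //; last exact: hE.
congr (_ *: _); rewrite /w sapply_sscale //.
- exact: lsupp_z12_theta12.
- exact: lsupp_Yz1_Yz2.
- by apply: hE; exact: lsupp_Yz1_Yz2.
Qed.

(** * Skew-symmetry inside iterated products *)

Definition Yz12_Ynz2 y := sapply Y12 (id_tens (Ysubst Y opp_z2 zeta2) y).

Lemma Yz12_Ynz2E y (m : int) (M : nat) i j k l :
  (forall n q, Ysnd n q y != 0 -> m <= n) -> j < m + M%:Z ->
  Yz12_Ynz2 y (i, j, (k, l)) = \sum_(p < M)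
    (-1) ^ (j - p%:Z) *: Y12 (Ysnd (j - p%:Z) l y) (i, p%:Z, (k, 0%N)).
Proof.
move=> hm hM; rewrite /Yz12_Ynz2 /sapply.
pose r : seq (expo * expo) :=
  [seq ((i, p%:Z, (k, 0%N)), (0, j - p%:Z, (0%N, l))) | p <- iota 0 M].
rewrite (fsbigE r) //.
- rewrite big_mkcond big_map -(big_mkord xpredT (fun p =>
    (-1) ^ (j - p%:Z) *: Y12 (Ysnd (j - p%:Z) l y) (i, p%:Z, (k, 0%N)))).
  rewrite /index_iota subn0; apply: eq_bigr => p _; rewrite ifT.
    by rewrite id_tens_opp_z2 /= (linZ (Ysubst_z12_lin _)).
  by rewrite inE /splits /= expoDE /= addr0 addn0 [_ + (j - _)]addrC subrK.
- by rewrite map_inj_uniq ?iota_uniq // => p q [].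
- move=> p /mapP[s _ ->]; rewrite /splits /= expoDE /= addr0 addn0.
  by rewrite [_ + (j - _)]addrC subrK.
move=> [a b] hab hn /=; apply/eqP/negPn/negP => h.
have [a0 a1] := Ysubst_z12_supp h.
have : id_tens (Ysubst Y opp_z2 zeta2) y b != 0.
  by apply: contra_neq h => ->; exact: lin0 (Ysubst_z12_lin a).
move: hab hn a0 a1 {h}; case: a b => [[a1 a2] [a3 a4]] [[b1 b2] [b3 b4]].
rewrite /splits /= expoDE /= => -[h1 h2 h3 h4] hn h5 h6; rewrite id_tens_opp_z2.
case: ifP => [/andP[/eqP h7 /eqP h8]|]; last by rewrite eqxx.
rewrite scaler_eq0 negb_or => /andP[_ /hm h9].
move/negP: hn; apply; apply/mapP; exists (absz a2); first by rewrite mem_iota; lia.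
by congr (_, _, (_, _), (_, _, (_, _))); lia.
Qed.

(* Skew-symmetry in the last two factors, followed by
   Y(a,z1) e^(z2 T) = e^(z2 T) Y(a,z12). *)
Lemma Yz12_Ynz2_skew y : Yz12_Ynz2 y = sapply expNT2 (Yz1_Yz2 (on23 P y)).
Proof.
apply/funext => -[[i j] [k l]].
have [N hN] := skew_symmetry_snd l y; have [m [L hm]] := Ysnd_bound y.
have [m' [L' hm']] := Ysnd_bound (on23 P y).
(* Large enough for skew-symmetry and for the lower bounds of both inner fields, so that one
   truncation serves all sums. *)
pose M := (absz (j + N%:Z)%R + absz (j - m)%R + absz (j - m')%R + 1)%N.
rewrite (@Yz12_Ynz2E y m M); last 2 first.
- by move=> n q /hm[].
- by rewrite /M; lia.
rewrite (@sapply_expNT2 _ M); last first.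
  move=> s hs; rewrite Yz1_Yz2E.
  have [->|/hm' [h _]] := eqVneq (Ysnd (j - s%:Z) l (on23 P y)) 0.
    exact: lin0 (Ycoef_lin _ _).
  by move: hs h; rewrite /M; lia.
pose f (s r : nat) : V := ((-1) ^ (j - s%:Z - r%:Z) * ((-1) ^+ s / (s`! * r`!)%:R)) *:
  iter s T (Yc i k (iter r T2 (Ysnd (j - s%:Z - r%:Z) l y))).
transitivity (\sum_(p < M) \sum_(s < p.+1) f s (p - s)%N).
  apply: eq_bigr => p _; rewrite Ysubst_z12_taylor scaler_sumr.
  apply: eq_bigr => s _; rewrite scalerA /f.
  by have -> : j - s%:Z - (p - s)%N%:Z = j - p%:Z by have := ltn_ord s; lia.
(* With T^s already taken out, skew-symmetry is applied at j - s and may be truncated at M - s,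
   which is exactly the triangle s + r < M. *)
rewrite -triangle_sum; apply: eq_bigr => s _; rewrite Yz1_Yz2E (hN _ (M - s)%N); last first.
  by have := ltn_ord s; rewrite /M; lia.
rewrite (lin_sum (Ycoef_lin _ _)) (lin_sum (iter_transl_lin _)) scaler_sumr.
apply: eq_bigr => r _.
rewrite (linZ (Ycoef_lin _ _)) (linZ (iter_transl_lin _)) scalerA /f; congr (_ *: _).
by rewrite natrM invfM mulrC !mulrA.
Qed.

(** Y(-z1, ζ1), the outer field of the right-hand side in exchanged variables. *)
Definition Yopp1 x : expo -> V := Ysubst Y opp_z2 zeta2 x \o sw.

Definition Ynz1_Yz2 y := sapply Yopp1 (tens_id (Ysubst Y z2 zeta2) y).

Lemma Yopp1E x i j k l : Yopp1 x (i, j, (k, l))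
  = if (j == 0) && (l == 0%N) then (-1) ^ i *: Yc i k x else 0.
Proof. exact: Ysubst_opp_z2. Qed.

Lemma Yopp1_lin e : linear (Yopp1 ^~ e).
Proof. exact: Ysubst_opp_z2_lin. Qed.

Lemma head1_opp1 : head1 Yopp1.
Proof.
move=> x; have [m [L h]] := Ycoef_bound x; exists m => -[[i j] [k l]].
rewrite Yopp1E; case: ifP => [/andP[/eqP -> _]|]; last by rewrite eqxx.
by rewrite scaler_eq0 negb_or /= addr0 => /andP[_ /h []].
Qed.

Lemma Ynz1_Yz2E y i j k l :
  Ynz1_Yz2 y (i, j, (k, l)) = (-1) ^ i *: Yc i k (Yfst j l y).
Proof.
rewrite /Ynz1_Yz2 sapply_sep ?Yopp1E ?tens_id_z2 ?eqxx //.
- by move=> e; exact: lin0 (Yopp1_lin e).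
- move=> x [[i' j'] [k' l']]; rewrite Yopp1E.
  by case: ifP => [/andP[/eqP -> /eqP ->]|]; rewrite ?eqxx.
- move=> [[i' j'] [k' l']]; rewrite tens_id_z2.
  by case: ifP => [/andP[/eqP -> /eqP ->]|]; rewrite ?eqxx.
Qed.

(** Naturality of the flip: Y is even, so moving c past Y(a, z) b costs the same sign as moving it
    past a and then past b. *)
Lemma flip_Ysnd n k y : P (Ysnd n k y) = Yfst n k (on23 P (on12 P y)).
Proof.
have P12l := on12_lin (@flip_lin K V); have P23l := on23_lin (@flip_lin K V).
move: y; apply: tens3_super_ind => [|s t hs ht|i1 i2 i3 c a b hc ha hb].
- rewrite (lin0 P12l) (lin0 P23l) (lin0 (Ysnd_lin _ _)) (lin0 flip_lin).
  by rewrite (lin0 (Yfst_lin _ _)).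
- rewrite (linD P12l) (linD P23l) (linD (Ysnd_lin _ _)) (linD flip_lin).
  by rewrite (linD (Yfst_lin _ _)) hs ht.
rewrite YsndE YcoefE (flip_homog hc (Yop_even ha hb n k)).
rewrite -tassocE on12E; last exact: flip_lin.
rewrite (flip_homog hc ha) (linZ (@tens_linl _ _ _ b)) (linZ tassoc_lin) (linZ P23l).
rewrite tassocE on23E; last exact: flip_lin.
rewrite (flip_homog hc hb) (linZ (tens_linr a)) !(linZ (Yfst_lin _ _)).
rewrite -tassocE YfstE YcoefE scalerA -signr_addb; congr (_ *: _).
by congr (_ ^+ nat_of_bool _); case: i1 {hc}; case: i2 {ha}; case: i3 {hb}.
Qed.

(** Skew-symmetry of the outer field read at -z1, that is Y(-z1) P = e^(-z1 T) Y(z1), with P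
    distributed over the inner field by [flip_Ysnd]. *)
Lemma Ynz1_Yz2_skew y : Ynz1_Yz2 (on23 P (on12 P y)) = sapply expNT1 (Yz1_Yz2 y).
Proof.
rewrite sapply_expNT1; apply/funext => -[[i j] [k l]]; rewrite Ynz1_Yz2E -flip_Ysnd /=.
have [N hN] := skew_symmetry k (P (Ysnd j l y)); have [m [L hm]] := Ycoef_bound (Ysnd j l y).
pose M := (absz (i + N%:Z)%R + absz (i - m)%R + 1)%N.
rewrite (hN _ M); last by rewrite /M; lia.
rewrite -[sw _]/(j, i, (l, k)) (@sapply_expNT2 _ M); last first.
  move=> s hs; rewrite -[(Yz1_Yz2 y \o sw) _]/(Yz1_Yz2 y (i - s%:Z, j, (k, l))) Yz1_Yz2E.
  by apply/eqP/negPn/negP => /hm [h _]; move: hs h; rewrite /M; lia.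
rewrite scaler_sumr; apply: eq_bigr => s _.
rewrite -[(Yz1_Yz2 y \o sw) _]/(Yz1_Yz2 y (i - s%:Z, j, (k, l))) Yz1_Yz2E flipK scalerA.
congr (_ *: _); rewrite mulrCA signzD signzN [X in _ * X]mulrA signz_sq mul1r.
by rewrite mulrC.
Qed.

Lemma associativity x : exists N : nat,
    sapply Y12 (sapply (id_tens (Ysubst Y opp_z2 zeta2))
        (sscale (spow z12 N) (sexp theta12 (on13 S) x)))
    = sapply (Ysubst Y opp_z2 zeta2) (sapply (tens_id (Ysubst Y z1 zeta1))
          (sscale (spow z12 N) (sexp theta21 (on13 S) x))).
Proof.
have Sl := @braid_lin K V; have Pl := @flip_lin K V.
have S13l : linear (on13 S).
  exact: comp_lin (on23_lin Pl) (comp_lin (on12_lin Sl) (on23_lin Pl)).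
(* For x = a ⊗ b ⊗ c these are, up to sign, a ⊗ c ⊗ b and c ⊗ a ⊗ b. The powers of S13 on x
   correspond to those of S12 on x', and also on x'' because S commutes with P. *)
pose x' := on23 P x; pose x'' := on12 P x'.
have [N hN] := locality_lin x'; exists N.
have iter12 n : iter n (on12 S) x'' = on12 P (iter n (on12 S) x').
  elim: n => //= n ->; rewrite on12_flip_comm // => t.
  exact: braiding_flip (braid_braiding V) t.
have [n hn] := S12_nilp x'.
have hn'' : iter n (on12 S) x'' = 0 by rewrite iter12 hn (lin0 (on12_lin Pl)).
have hn13 : iter n (on13 S) x = 0 by rewrite iter_on13 hn (lin0 (on23_lin Pl)).
have -> : sapply Y12 (sapply (id_tens (Ysubst Y opp_z2 zeta2))
        (sscale (spow z12 N) (sexp theta12 (on13 S) x))) = sapply expNT2 (loc_series N x').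
  rewrite (sapply_loc_series N expNT2_lin jpred_expNT2 hn).
  rewrite (sapply2_sexp Ysubst_z12_lin (fun e => id_tens_lin e Ysubst_opp_z2_lin)
    head1_z12 tail2_opp_z2 (lsupp_spow_z12 N) lsupp_spow_theta12 S13l hn13).
  apply/funext => e; apply: eq_bigr => k _.
  by rewrite -/(Yz12_Ynz2 _) Yz12_Ynz2_skew iter_on13 on23_flipK.
rewrite (@swap_fields _ _ _ _ Yopp1 _ (tens_id (Ysubst Y z2 zeta2))); last 4 first.
- exact: Yopp1_lin.
- by move=> e; apply: tens_id_lin; exact: Ysubst_z2_lin.
- by move=> t; apply/funext => e; rewrite /Yopp1 /= swK.
- move=> y; apply/funext => e; rewrite /tens_id /=; congr (tmap _ id _).
  by apply/funext => t; rewrite Ysubst_sw /= swK.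
have -> : sapply Yopp1 (sapply (tens_id (Ysubst Y z2 zeta2))
        (sscale (spow z12 N) (sexp theta12 (on13 S) x))) = sapply expNT1 (loc_series N x'').
  rewrite (sapply_loc_series N expNT1_lin jpred_expNT1 hn'').
  rewrite (sapply2_sexp Yopp1_lin (fun e => tens_id_lin e Ysubst_z2_lin)
    head1_opp1 tail2_tens_z2 (lsupp_spow_z12 N) lsupp_spow_theta12 S13l hn13).
  apply/funext => e; apply: eq_bigr => k _.
  by rewrite -/(Ynz1_Yz2 _) -Ynz1_Yz2_skew iter12 on12_flipK iter_on13.
(* Undoing the exchange turns e^(-z1 T) back into e^(-z2 T), so both sides are this exponential
   applied to the two sides of locality for x', with the same sign (-1)^N. *)
apply/funext => e.
rewrite sapply_expNT1 [in RHS]/= swK.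
rewrite /sapply -fsum_scale; apply: eq_fsbigr => p _.
by rewrite -(linZ (expNT2_lin _)) hN.
Qed.

End Exponential.

Theorem proposition3p23 (R : realType) (V : logVA (R[i])%C) (a b c : V) :
  exists N : nat,
    sapply (Ysubst (@Yop _ V) iota_z12 theta12)
      (sapply (id_tens (Ysubst (@Yop _ V) opp_z2 zeta2))
        (sscale (spow z12 N)
          (sexp theta12 (on13 (braid V)) (a ⊗ (b ⊗ c)))))
    = sapply (Ysubst (@Yop _ V) opp_z2 zeta2)
        (sapply (tens_id (Ysubst (@Yop _ V) z1 zeta1))
          (sscale (spow z12 N)
            (sexp theta21 (on13 (braid V)) (a ⊗ (b ⊗ c))))).
Proof. exact: associativity. Qed.
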